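(* Let $T>0$, let $a_r\in H^2(0,T;\mathbb R^n)$, suppose $\operatorname{rank}C_\varepsilon=n$, let $C_\varepsilon^\dagger$ be a fixed right inverse of $C_\varepsilon$, and set $$\eta_r=C_\varepsilon^\dagger(\ddot a_r+\Lambda a_r),\qquad u_r=(\partial_t^2+2\Gamma_\varepsilon\partial_t+K_\varepsilon)\eta_r .$$ Let $I_1,\dots,I_{N_c}\subset(0,\infty)$ be compact. If $(\eta_r)_\alpha\in\mathcal B_T(I_\alpha)$ for all $\alpha=1,\dots,N_c$, then $$\|u_r\|_{L^2(0,T)}^2\le\sum_{\alpha=1}^{N_c}\Big(\sup_{\nu\in I_\alpha}d_{\alpha,\varepsilon}(\nu)\Big)^2\|(\eta_r)_\alpha\|_{\mathcal B_T(I_\alpha)}^2 .$$ In particular, $$\|u_r\|_{L^2(0,T)}\le\Delta_\varepsilon(I_1,\dots,I_{N_c})\,\|\eta_r\|_{\prod_\alpha\mathcal B_T(I_\alpha)} .$$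
   Context: $\Lambda=\operatorname{diag}(\omega_1^2,\dots,\omega_n^2)$ with $\omega_k>0$; $C_\varepsilon\in\mathbb R^{n\times N_c}$ is a real matrix. For $\alpha=1,\dots,N_c$, $\gamma_\alpha^\varepsilon>0$ and $\omega_\alpha^\varepsilon>0$ are given numbers, and $\Gamma_\varepsilon=\operatorname{diag}(\gamma_\alpha^\varepsilon)$, $K_\varepsilon=\operatorname{diag}((\omega_\alpha^\varepsilon)^2+(\gamma_\alpha^\varepsilon)^2)$. Define $$d_{\alpha,\varepsilon}(\nu)=\big|(\omega_\alpha^\varepsilon)^2+(\gamma_\alpha^\varepsilon)^2-\nu^2+2\mathrm i\gamma_\alpha^\varepsilon\nu\big|,\qquad \Delta_\varepsilon(I_1,\dots,I_{N_c})=\max_{1\le\alpha\le N_c}\sup_{\nu\in I_\alpha}d_{\alpha,\varepsilon}(\nu).$$ Finite-time band class: for compact $I\subset(0,\infty)$, $g\in L^2(0,T)$ belongs to $\mathcal B_T(I)$ if there is $\widetilde g\in L^2(\mathbb R)$ with $\widetilde g|_{(0,T)}=g$ and $\operatorname{supp}\widehat{\widetilde g}\subset I\cup(-I)$; the norm is $\|g\|_{\mathcal B_T(I)}=\inf\|\widetilde g\|_{L^2(\mathbb R)}$ over all such $\widetilde g$. The Fourier transform uses angular frequency, $\widehat{\partial_t g}(\nu)=\mathrm i\nu\widehat g(\nu)$. Elements of $\mathcal B_T(I)$ are identified with their smooth representatives. The product norm is $\|\eta\|_{\prod_\alpha\mathcal B_T(I_\alpha)}^2=\sum_{\alpha=1}^{N_c}\|\eta_\alpha\|_{\mathcal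 B_T(I_\alpha)}^2$. *)

(* Defs.v *)
From HB Require Import structures.
From mathcomp Require Import all_boot all_order all_algebra.
From mathcomp Require Import all_classical all_reals all_analysis.
From mathcomp Require Import complex.

Set Implicit Arguments.
Unset Strict Implicit.
Unset Printing Implicit Defensive.

Import Order.TTheory GRing.Theory Num.Theory.
Import numFieldNormedType.Exports.

Local Open Scope classical_set_scope.
Local Open Scope ring_scope.
Local Open Scope complex_scope.

Section RealFunctions.
Context {R : realType}.
Local Notation mu := (@lebesgue_measure R).
Implicit Types (T : R) (f g h phi : R -> R).

Definition component (n : nat) (v : R -> 'cV[R]_n) (i : 'I_n) (t : R) : R :=
  v t i 0.

Definition in_L2 (D : set R) f : Prop := f \_ D \in Lfun mu 2%:E.

Definition smooth_on (D : set R) f : Prop :=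
  forall (k : nat) (x : R), D x -> derivable (derive1n k f) x 1.

Definition test_function (D : set R) phi : Prop :=
  smooth_on setT phi /\
  exists2 K : set R, compact K /\ K `<=` D & forall x, ~ K x -> phi x = 0.

(* [g] is the [k]-th weak derivative of [f] on (0,T), both being square
   integrable; without integrability of [g] the last integral would be the
   default value of [Rintegral]. *)
Definition weak_derivative T (k : nat) f g : Prop :=
  [/\ in_L2 `]0, T[ f, in_L2 `]0, T[ g &
      forall phi, test_function `]0, T[ phi ->
        Rintegral mu `]0, T[ (fun t => f t * derive1n k phi t) =
        (-1) ^+ k * Rintegral mu `]0, T[ (fun t => g t * phi t)].

Definition in_H2 T (n : nat) (a : R -> 'cV[R]_n) : Prop :=
  forall i, exists f1 f2,
    weak_derivative T 1 (component a i) f1 /\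
    weak_derivative T 2 (component a i) f2.

Definition vweak_derivative T (k n : nat) (a b : R -> 'cV[R]_n) : Prop :=
  forall i, weak_derivative T k (component a i) (component b i).

Definition L2norm T (n : nat) (u : R -> 'cV[R]_n) : \bar R :=
  sqrte (\int[mu]_(t in `]0%R, T[) (\sum_i component u i t ^+ 2)%R%:E)%E.

Definition is_smooth_rep T g h : Prop :=
  smooth_on `]0, T[ h /\ ae_eq mu [set` `]0, T[] g h.

(* Band-limited functions have a smooth representative; the default [g] is the
   value for functions that have none.  The values on (0,T) do not depend on
   the choice, because two continuous functions on (0,T) that agree almost
   everywhere are equal there. *)
Definition smooth_rep T g : R -> R := xget g [set h | is_smooth_rep T g h].

End RealFunctions.

Section BandClass.
Context {R : realType}.
Local Notation mu := (@lebesgue_measure R).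
Implicit Types (T : R) (f F : R -> R[i]) (I : set R) (g : R -> R).

Definition in_CL2 f : Prop :=
  (fun x => complex.Re (f x)) \in Lfun mu 2%:E /\
  (fun x => complex.Im (f x)) \in Lfun mu 2%:E.

Definition CL2norm f : \bar R := Lnorm mu 2%:E (fun x => (Normc.normc (f x))%:E).

Definition Cintegral (D : set R) f : R[i] :=
  Rintegral mu D (fun x => complex.Re (f x)) +i*
  Rintegral mu D (fun x => complex.Im (f x)).

Definition truncated_fourier f (A nu : R) : R[i] :=
  Cintegral `[- A, A] (fun t => f t * (cos (nu * t) -i* sin (nu * t))).

(* The Fourier transform on L^2(R), with kernel exp(- i nu t), is the limit in
   L^2(R) of the integrals over [-A, A]; it is determined up to a null set. *)
Definition is_fourier f F : Prop :=
  [/\ in_CL2 f, in_CL2 F &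
      CL2norm (fun nu => truncated_fourier f A nu - F nu) @[A --> +oo] --> 0%E].

(* Support of an almost-everywhere class: the complement of the largest open
   set on which [F] vanishes almost everywhere. *)
Definition ess_support F : set R :=
  [set x | forall U, nbhs x U -> ~ {ae mu, forall y, U y -> F y = 0}].

Definition band_extension T I g (gt : R -> R[i]) : Prop :=
  [/\ in_CL2 gt, ae_eq mu [set` `]0, T[] gt (fun t => (g t)%:C) &
      exists2 F, is_fourier gt F & ess_support F `<=` I `|` (-%R @` I)].

Definition in_band T I g : Prop :=
  in_L2 `]0, T[ g /\ exists gt, band_extension T I g gt.

Definition band_norm T I g : \bar R :=
  ereal_inf [set CL2norm gt | gt in band_extension T I g].

Definition prod_band_norm T (N : nat) (I : 'I_N -> set R)
    (eta : R -> 'cV[R]_N) : \bar R :=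
  sqrte (\sum_alpha band_norm T (I alpha) (component eta alpha) ^+ 2)%E.

End BandClass.

Section Control.
Context {R : realType} {N : nat}.
Variables gamma omega : 'I_N -> R.

Definition dsymbol (alpha : 'I_N) (nu : R) : R :=
  Normc.normc ((omega alpha ^+ 2 + gamma alpha ^+ 2 - nu ^+ 2)%:C
               + 2 * 'i * (gamma alpha)%:C * nu%:C).

(* On the empty set [sup] is 0, the supremum in [0, +oo[. *)
Definition dsup (alpha : 'I_N) (I : set R) : R :=
  sup [set dsymbol alpha nu | nu in I].

Definition Delta (I : 'I_N -> set R) : R :=
  \big[Num.max/0]_alpha dsup alpha (I alpha).

Definition Gamma : 'M[R]_N := diag_mx (\row_alpha gamma alpha).

Definition Kmx : 'M[R]_N :=
  diag_mx (\row_alpha (omega alpha ^+ 2 + gamma alpha ^+ 2)).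

Definition control (T : R) (eta : R -> 'cV[R]_N) (t : R) : 'cV[R]_N :=
  let d (k : nat) := \col_alpha derive1n k (smooth_rep T (component eta alpha)) t in
  d 2%N + (2 *: Gamma) *m d 1%N + Kmx *m d 0%N.

End Control.

(* Main.v *)
(** Write f for an extension of eta_alpha to the line and F for its Fourier
transform, which vanishes off the compact set I \cup -I.  Everything rests on
the Poisson kernel: the transform of exp(-e|v|) is 2e/(e^2+z^2), so by Fubini
the e-weighted L^2 pairing of two transforms is the pairing of the functions
against this kernel.  As the kernel has mass 2 pi, letting e tend to 0 gives
Bessel's inequality |f^|^2 <= 2 pi |f|^2 for boundedly supported f, and, pairing
with the indicator of [x, y] (where the kernel integrates to arctangents), it
gives the inversion formula in integrated form.  Hence Re f = eta_alpha agrees almost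
everywhere on (0,T) with the real part G of the inverse transform of F, which is
smooth, and the differential operator acts on G by multiplying F by the symbol.  Bessel's inequality, used
once for f -> F and once for F -> u, then bounds u. *)
Require Import Defs.
From HB Require Import structures.
From mathcomp Require Import all_boot all_order all_algebra.
From mathcomp Require Import all_classical all_reals all_analysis.
From mathcomp Require Import measurable_realfun complex ring lra.

Set Implicit Arguments.
Unset Strict Implicit.
Unset Printing Implicit Defensive.

Import Order.TTheory GRing.Theory Num.Theory.
Import numFieldNormedType.Exports.

Local Open Scope classical_set_scope.
Local Open Scope ring_scope.

(** * Integrable and square-integrable functions on the line *)

Section Integrable.
Context {R : realType}.
Local Notation mu := (@lebesgue_measure R).
Implicit Types (f g h : R -> R).

(** The transform [F] is given only as an L^2 limit of transforms of truncations. So everything is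
    proved for bounded support, where the integrals converge absolutely, and carried over by
    squared-error estimates. A one-sided Bessel bound in each direction takes the place of
    Plancherel's theorem. No constant is lost, because the inversion factor enters squared: [2 pi]
    from each use of Bessel against [(2 pi)^-2]. An extension of real data may be complex; functions
    are therefore handled as pairs of real ones, the cross terms between real and imaginary parts
    drop out by parity, and taking the real part at the end can only decrease the norm. The function
    G depends on the chosen extension, whereas u on (0,T) does not: smooth functions equal almost
    everywhere on (0,T) are equal there with all derivatives. So one and the same left side is
    bounded through every extension, and the infimum in the band norm is taken last. *)

Definition L1 f := mu.-integrable setT (EFin \o f).
(** Measurability of [f] is a separate clause because it does not follow from that of [f ^+ 2]. *)
Definition L2 f := measurable_fun setT f /\ L1 (fun x => f x ^+ 2).

Lemma L1_measurable f : L1 f -> measurable_fun setT f.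
Proof. by move=> /measurable_int /measurable_EFinP. Qed.

Lemma L1_le f g : measurable_fun setT f -> (forall x, `|f x| <= g x) ->
  L1 g -> L1 f.
Proof.
move=> mf fg; apply: le_integrable => //; first exact/measurable_EFinP.
by move=> x _; rewrite !abse_EFin lee_fin (le_trans (fg x))// ler_norm.
Qed.

Lemma L1_eq f g : L1 f -> f =1 g -> L1 g.
Proof. by move=> + /funext <-. Qed.

Lemma L1D f g : L1 f -> L1 g -> L1 (fun x => f x + g x).
Proof. by move=> lf lg; exact: (integrableD measurableT lf lg). Qed.

Lemma L1B f g : L1 f -> L1 g -> L1 (fun x => f x - g x).
Proof. by move=> lf lg; exact: (integrableB measurableT lf lg). Qed.

Lemma L1Z c f : L1 f -> L1 (fun x => c * f x).
Proof. by move=> lf; exact: (integrableZl measurableT c lf). Qed.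

Lemma L1_norm f : L1 f -> L1 (fun x => `|f x|).
Proof. by move=> lf; exact: integrable_norm. Qed.

Lemma L1Mb f h C : L1 f -> measurable_fun setT h -> (forall x, `|h x| <= C) ->
  L1 (fun x => f x * h x).
Proof.
move=> lf mh hC; apply: (@L1_le _ (fun x => C * `|f x|)).
- by apply: measurable_funM => //; exact: L1_measurable.
- by move=> x; rewrite normrM mulrC ler_wpM2r.
- exact/L1Z/L1_norm.
Qed.

Lemma L1_indic a b : L1 (\1_`[a, b]).
Proof. exact: integrable_indic_itv. Qed.

Lemma L2_indic a b : L2 (\1_`[a, b]).
Proof.
split; first exact: measurable_indic.
apply: (L1_eq (L1_indic a b)) => x; rewrite indicE.
by case: (_ \in _); rewrite ?expr1n ?expr0n.
Qed.

Lemma L2_mul f g : L2 f -> L2 g -> L1 (fun x => f x * g x).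
Proof.
move=> [mf lf] [mg lg]; apply: (@L1_le _ (fun x => f x ^+ 2 + g x ^+ 2)).
- exact: measurable_funM.
- move=> x; rewrite normrM -(real_normK (num_real (f x))) -(real_normK (num_real (g x))).
  set a := `|f x|; set b := `|g x|.
  have := sqr_ge0 (a - b); have : 0 <= a := normr_ge0 _.
  have : 0 <= b := normr_ge0 _.
  nra.
- exact: L1D.
Qed.

Lemma L2D f g : L2 f -> L2 g -> L2 (fun x => f x + g x).
Proof.
move=> lf lg; split; first by apply: measurable_funD; [exact: lf.1|exact: lg.1].
apply: (@L1_eq (fun x => f x ^+ 2 + g x ^+ 2 + 2 * (f x * g x))).
  by apply: L1D; [apply: L1D; [exact: lf.2|exact: lg.2]|exact/L1Z/L2_mul].
by move=> x; ring.
Qed.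

Lemma L2Mb f h C : L2 f -> measurable_fun setT h -> (forall x, `|h x| <= C) ->
  L2 (fun x => f x * h x).
Proof.
move=> [mf lf] mh hC; split; first exact: measurable_funM.
apply: (@L1_eq (fun x => f x ^+ 2 * h x ^+ 2)); last by move=> x; ring.
apply: (@L1Mb _ _ (C ^+ 2)) => //; first exact: measurable_funX.
by move=> x; rewrite normrX lerXn2r// nnegrE// (le_trans _ (hC x)).
Qed.

Lemma L2Z c f : L2 f -> L2 (fun x => c * f x).
Proof.
move=> lf; have [m l] := @L2Mb f (cst c) `|c| lf (measurable_cst _) (fun=> lexx _).
by split; [under eq_fun do rewrite mulrC|under eq_fun do rewrite mulrC].
Qed.

Lemma L2B f g : L2 f -> L2 g -> L2 (fun x => f x - g x).
Proof.
move=> lf lg; have := L2D lf (L2Z (-1) lg).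
by under eq_fun do rewrite mulN1r.
Qed.

(** Pairing with the indicator of [[-M, M]]. On bounded supports the transforms of L^2 functions are
    thus plain integrals. *)
Lemma L2_L1 f M : L2 f -> (forall x, M < `|x| -> f x = 0) -> L1 f.
Proof.
move=> lf f0; apply: (@L1_eq (fun x => f x * \1_`[-M, M] x)).
  exact/L2_mul/L2_indic.
move=> x; rewrite indicE mem_setE in_itv/= -ler_norml.
by have [|/f0 ->] := leP `|x| M; rewrite ?mulr1// mul0r.
Qed.

Lemma intD f g : L1 f -> L1 g ->
  \int[mu]_x (f x + g x) = \int[mu]_x f x + \int[mu]_x g x.
Proof. by move=> *; exact: RintegralD. Qed.

Lemma intB f g : L1 f -> L1 g ->
  \int[mu]_x (f x - g x) = \int[mu]_x f x - \int[mu]_x g x.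
Proof. by move=> *; exact: RintegralB. Qed.

Lemma intZ c f : L1 f -> \int[mu]_x (c * f x) = c * \int[mu]_x f x.
Proof. by move=> *; exact: RintegralZl. Qed.

Lemma int_le f g : L1 f -> L1 g -> (forall x, f x <= g x) ->
  \int[mu]_x f x <= \int[mu]_x g x.
Proof. by move=> lf lg fg; apply: le_Rintegral. Qed.

Lemma int_eq f g : f =1 g -> \int[mu]_x f x = \int[mu]_x g x.
Proof. by move=> fg; apply: eq_Rintegral => x _. Qed.

Lemma int_EFin f : L1 f -> (\int[mu]_x (f x)%:E)%E = (\int[mu]_x f x)%:E.
Proof. by move=> lf; rewrite fineK//; exact: integrable_fin_num. Qed.

Lemma int_abs_le f g : L1 g -> measurable_fun setT f ->
  (forall x, `|f x| <= g x) -> `|\int[mu]_x f x| <= \int[mu]_x g x.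
Proof.
move=> lg mf fg; have lf := L1_le mf fg lg.
apply: le_trans (le_normr_Rintegral _ lf) _ => //.
by apply: int_le => //; exact: L1_norm.
Qed.

(** The product [a(x) b(y) k(x, y)] is dominated by [C |a(x)| |b(y)|], so each exchange of the order
    of integration below reduces to an integrable pair and a bounded kernel. Integrability of the
    outer integrand is recorded too, since it carries measurability in the parameter. *)
Lemma fubini_kernel (a b : R -> R) (k : R * R -> R) C :
  L1 a -> L1 b -> measurable_fun setT k -> (forall p, `|k p| <= C) ->
  L1 (fun x => a x * \int[mu]_y (b y * k (x, y))) /\
  \int[mu]_x (a x * \int[mu]_y (b y * k (x, y))) =
  \int[mu]_y (b y * \int[mu]_x (a x * k (x, y))).
Proof.
move=> la lb mk kC.
have ma := L1_measurable la; have mb := L1_measurable lb.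
have C0 : 0 <= C by rewrite (le_trans _ (kC (0, 0))).
have mk1 x : measurable_fun setT (fun y => k (x, y)).
  exact: measurableT_comp.
have mk2 y : measurable_fun setT (fun x => k (x, y)).
  exact: measurableT_comp.
have l1 x : L1 (fun y => b y * k (x, y)) by exact: L1Mb (mk1 x) _.
have l2 y : L1 (fun x => a x * k (x, y)) by exact: L1Mb (mk2 y) _.
pose h := fun p : R * R => a p.1 * b p.2 * k p.
have mh : measurable_fun setT h.
  apply: measurable_funM => //; apply: measurable_funM;
    exact: measurableT_comp.
have ih : (mu \x mu)%E.-integrable setT (EFin \o h).
  apply/integrable12ltyP; first exact/measurable_EFinP.
  apply: (@le_lt_trans _ _ (\int[mu]_x (`|a x| * (C * \int[mu]_y `|b y|))%:E)%E).
    apply: ge0_le_integral => //.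
    - by move=> x _; apply: integral_ge0.
    - have mF : measurable_fun setT (fubini_F mu (abse \o (EFin \o h))).
        apply: measurable_fun_fubini_tonelli_F => //=.
        by apply: measurableT_comp => //; exact/measurable_EFinP.
      exact: mF.
    - by apply/measurable_EFinP; apply: measurable_funM => //; exact: measurableT_comp.
    - move=> x _; apply: (@le_trans _ _ (\int[mu]_y (`|a x| * (C * `|b y|))%:E)%E).
        apply: ge0_le_integral => //.
        + apply/measurable_EFinP; apply: measurableT_comp => //.
          by apply: (measurableT_comp mh); exact: measurable_pair1.
        + apply/measurable_EFinP; apply: measurable_funM => //.
          by apply: measurable_funM => //; exact: measurableT_comp.
        + move=> y _; rewrite lee_fin /h/= !normrM -mulrA ler_wpM2l//.
          by rewrite mulrC ler_wpM2r.
      rewrite int_EFin ?intZ//; [exact: L1_norm|exact/L1Z/L1_norm|].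
      by apply/L1Z/L1Z/L1_norm.
  under eq_integral do rewrite mulrC.
  by rewrite int_EFin ?ltry//; exact/L1Z/L1_norm.
have e1 x : (\int[mu]_y (h (x, y))%:E)%E = (a x * \int[mu]_y (b y * k (x, y)))%:E.
  under eq_integral do rewrite /h/= -mulrA.
  by rewrite int_EFin ?intZ//; exact: L1Z.
have e2 y : (\int[mu]_x (h (x, y))%:E)%E = (b y * \int[mu]_x (a x * k (x, y)))%:E.
  under eq_integral do rewrite /h/= (mulrC (a _)) -mulrA.
  by rewrite int_EFin ?intZ//; exact: L1Z.
split.
  have := integrable_fubini_F ih; apply: eq_integrable => // x _.
  by rewrite /fubini_F/= e1.
rewrite /Rintegral; congr fine.
have := Fubini ih => /=.
under eq_integral do rewrite e1.
by under [X in _ = X]eq_integral do rewrite e2.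
Qed.

End Integrable.

(** * The Poisson kernel *)

Section Kernel.
Context {R : realType}.
Local Notation mu := (@lebesgue_measure R).
Implicit Types (e z x y : R) (f g h : R -> R).

Definition abel_weight e x : R := expR (- (e * `|x|)).

Definition poisson e z : R := 2 * e / (e ^+ 2 + z ^+ 2).

Lemma continuous_abel_weight e : continuous (abel_weight e).
Proof.
rewrite /abel_weight => x.
have c : {for x, continuous (fun x => - (e * `|x|))}.
  apply: continuousN; apply: continuousM; first exact: cvg_cst.
  exact: norm_continuous.
exact: (continuous_comp c (@continuous_expR R _)).
Qed.

Lemma measurable_abel_weight e : measurable_fun setT (abel_weight e).
Proof. by apply: continuous_measurable_fun; exact: continuous_abel_weight. Qed.

Let primitive e z x : R := expR (- (e * x)) *
  ((z * sin (z * x) - e * cos (z * x)) / (e ^+ 2 + z ^+ 2) - e^-1).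

Let is_derive_primitive e z x : 0 < e ->
  is_derive x 1 (primitive e z) (expR (- (e * x)) * (1 + cos (z * x))).
Proof.
move=> e0; have ez : e ^+ 2 + z ^+ 2 != 0.
  by rewrite gt_eqF// ltr_pwDl ?sqr_ge0// exprn_gt0.
rewrite /primitive; apply: is_derive_eq.
rewrite /GRing.scale/=.
field.
by rewrite ez gt_eqF.
Qed.

Let cvg_primitive e z : 0 < e -> primitive e z x @[x --> +oo] --> 0.
Proof.
move=> e0; set C := (`|z| + e) / (e ^+ 2 + z ^+ 2) + e^-1.
have ez : 0 < e ^+ 2 + z ^+ 2 by rewrite ltr_pwDl ?sqr_ge0// exprn_gt0.
have bnd x : `|primitive e z x| <= C * expR (- (e * x)).
  rewrite /primitive normrM mulrC (ger0_norm (expR_ge0 _)).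
  rewrite ler_wpM2r ?expR_ge0// /C (le_trans (ler_normB _ _))//.
  rewrite [`|e^-1|]ger0_norm ?invr_ge0 ?(ltW e0)// lerD2r.
  rewrite normrM [`|_^-1|]ger0_norm ?invr_ge0 ?(ltW ez)//.
  rewrite ler_wpM2r ?invr_ge0 ?(ltW ez)// (le_trans (ler_normB _ _))//.
  rewrite !normrM (ger0_norm (ltW e0)) lerD// ler_piMr ?normr_ge0 ?(ltW e0)//.
    by rewrite ler_norml sin_geN1 sin_le1.
  by rewrite ler_norml cos_geN1 cos_le1.
have lim : C * expR (- (e * x)) @[x --> +oo] --> 0.
  rewrite -(mulr0 C); apply: cvgMr.
  apply: (@cvg_comp _ _ _ (fun x => e * x) (fun x => expR (- x)) _ +oo).
    exact: gt0_cvgMry.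
  exact: cvgr_expR.
apply/cvgr0Pnorm_le => d d0.
have /cvgr0Pnorm_le/(_ d d0) := lim.
apply: filterS => x; apply: le_trans.
by rewrite (le_trans (bnd x))// ler_norm.
Qed.

(* Adding 1 to the cosine makes the integrand nonnegative, as the improper
   fundamental theorem of calculus requires. *)
Let integral_abel_weight1Dcos e z : 0 < e ->
  (\int[mu]_x (abel_weight e x * (1 + cos (z * x)))%:E)%E =
  (2 / e + poisson e z)%:E.
Proof.
move=> e0; have ez : e ^+ 2 + z ^+ 2 != 0.
  by rewrite gt_eqF// ltr_pwDl ?sqr_ge0// exprn_gt0.
have cz : continuous (fun x : R => 1 + cos (z * x)).
  move=> x; apply: continuousD; first exact: cvg_cst.
  apply: continuous_comp; last exact: continuous_cos.
  exact: mulrl_continuous.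
pose f : R -> R := fun x => expR (- (e * x)) * (1 + cos (z * x)).
have cf : continuous f.
  move=> x; apply: (@continuousM R R (fun x => expR (- (e * x)))
    (fun x => 1 + cos (z * x))); last exact: cz.
  apply: continuous_comp; last exact: continuous_expR.
  by apply: continuousN; exact: mulrl_continuous.
rewrite ge0_symfun_integralT; first last.
- by move=> x /=; rewrite /abel_weight normrN mulrN cosN.
- move=> x; apply: continuousM; last exact: cz.
  exact: continuous_abel_weight.
- by move=> x; rewrite mulr_ge0 ?expR_ge0// -lerBlDl sub0r cos_geN1.
rewrite -set_itvcy.
have -> : (\int[mu]_(x in `[0%R, +oo[) (abel_weight e x * (1 + cos (z * x)))%:E =
    \int[mu]_(x in `[0%R, +oo[) (f x)%:E)%E.
  apply: eq_integral => x; rewrite inE/= in_itv/= andbT => x0.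
  by rewrite /abel_weight ger0_norm.
rewrite (@ge0_continuous_FTC2y _ _ (primitive e z) 0 0).
- rewrite -EFinB -EFinM; congr EFin.
  rewrite /primitive /poisson !mulr0 oppr0 expR0 sin0 cos0; field.
  by rewrite ez gt_eqF.
- by move=> x _; rewrite mulr_ge0 ?expR_ge0// -lerBlDl sub0r cos_geN1.
- exact: continuous_subspaceT.
- exact: cvg_primitive.
- by move=> x _; have [] := is_derive_primitive z x e0.
- apply: cvg_at_right_filter.
  apply: differentiable_continuous; apply/derivable1_diffP.
  by have [] := is_derive_primitive z 0 e0.
- move=> x _; rewrite derive1E.
  by have [] := is_derive_primitive z x e0.
Qed.

Lemma L1_abel_weight e : 0 < e -> L1 (abel_weight e).
Proof.
(* At frequency 0 the factor [1 + cos] is the constant 2. *)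
move=> e0; have l2 : L1 (fun x => abel_weight e x * (1 + cos (0 * x))).
  apply/integrableP; split.
    apply/measurable_EFinP; apply: measurable_funM.
      exact: measurable_abel_weight.
    by under eq_fun do rewrite mul0r; exact: measurable_cst.
  under eq_integral => x _.
    rewrite gee0_abs ?lee_fin; last first.
      by rewrite mulr_ge0 ?expR_ge0// -lerBlDl sub0r cos_geN1.
    over.
  by rewrite integral_abel_weight1Dcos// ltry.
apply: (L1_eq (L1Z 2^-1 l2)) => x; rewrite mul0r cos0.
by field.
Qed.

Lemma measurable_cosM z : measurable_fun setT (fun x : R => cos (z * x)).
Proof.
apply: measurableT_comp; last exact: mulrl_measurable.
by apply: continuous_measurable_fun; exact: continuous_cos.
Qed.

Lemma measurable_sinM z : measurable_fun setT (fun x : R => sin (z * x)).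
Proof.
apply: measurableT_comp; last exact: mulrl_measurable.
by apply: continuous_measurable_fun; exact: continuous_sin.
Qed.

Lemma norm_cos_le1 x : `|cos x| <= 1.
Proof. by rewrite ler_norml cos_geN1 cos_le1. Qed.

Lemma norm_sin_le1 x : `|sin x| <= 1.
Proof. by rewrite ler_norml sin_geN1 sin_le1. Qed.

Lemma int_abel_weight_cos e z : 0 < e ->
  \int[mu]_x (abel_weight e x * cos (z * x)) = poisson e z.
Proof.
move=> e0; have lw := L1_abel_weight e0.
have lc y : L1 (fun x => abel_weight e x * cos (y * x)).
  by apply: (L1Mb lw (measurable_cosM y)) => x; exact: norm_cos_le1.
have eq1 y : \int[mu]_x (abel_weight e x * cos (y * x)) =
    2 / e + poisson e y - \int[mu]_x abel_weight e x.
  have := congr1 fine (integral_abel_weight1Dcos y e0) => /= <-.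
  under eq_integral do rewrite mulrDr mulr1.
  by rewrite -/(Rintegral _ _ _) intD// addrC addKr.
(* The total mass [W] of the weight is still unknown. At [y = 0] the relation reads [W = 4 / e - W],
   hence [W = 2 / e]. *)
have := eq1 0.
rewrite (int_eq (g := abel_weight e)); last by move=> x; rewrite mul0r cos0 mulr1.
rewrite eq1; have -> : poisson e 0 = 2 / e.
  by rewrite /poisson expr0n addr0; field; rewrite gt_eqF.
set W := Rintegral _ _ _; move: (2 / e) (poisson e z) => d p; lra.
Qed.

End Kernel.

(** * Cosine and sine transforms and their weighted pairing *)

Section Transform.
Context {R : realType}.
Local Notation mu := (@lebesgue_measure R).
Implicit Types (e z x y : R) (f g h : R -> R).

(** For real [f] the Fourier transform with kernel exp(- i y x) is [cosT f - i sinT f], so its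
    squared modulus is [cosT f ^+ 2 + sinT f ^+ 2]. *)
Definition cosT f y := \int[mu]_x (f x * cos (y * x)).
Definition sinT f y := \int[mu]_x (f x * sin (y * x)).

Lemma L1_cosM f y : L1 f -> L1 (fun x => f x * cos (y * x)).
Proof.
by move=> lf; apply: (L1Mb lf (measurable_cosM y)) => x; exact: norm_cos_le1.
Qed.

Lemma L1_sinM f y : L1 f -> L1 (fun x => f x * sin (y * x)).
Proof.
by move=> lf; apply: (L1Mb lf (measurable_sinM y)) => x; exact: norm_sin_le1.
Qed.

Lemma cosTZ c f y : L1 f ->
  c * cosT f y = \int[mu]_x (c * (f x * cos (y * x))).
Proof. by move=> lf; rewrite intZ//; exact: L1_cosM. Qed.

Lemma sinTZ c f y : L1 f ->
  c * sinT f y = \int[mu]_x (c * (f x * sin (y * x))).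
Proof. by move=> lf; rewrite intZ//; exact: L1_sinM. Qed.

Lemma norm_cosT_le f y : L1 f -> `|cosT f y| <= \int[mu]_x `|f x|.
Proof.
move=> lf; apply: int_abs_le; [exact: L1_norm|by apply: L1_measurable; exact: L1_cosM|].
by move=> x; rewrite normrM ler_piMr// norm_cos_le1.
Qed.

Lemma norm_sinT_le f y : L1 f -> `|sinT f y| <= \int[mu]_x `|f x|.
Proof.
move=> lf; apply: int_abs_le; [exact: L1_norm|by apply: L1_measurable; exact: L1_sinM|].
by move=> x; rewrite normrM ler_piMr// norm_sin_le1.
Qed.

(** Fubini makes the product of the parametric integral with an integrable positive weight
    integrable, hence measurable. The weight is then divided out: [abel_weight (-1)] is the inverse
    of [abel_weight 1]. *)
Lemma measurable_kernel_int f (k : R * R -> R) C :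
  L1 f -> measurable_fun setT k -> (forall p, `|k p| <= C) ->
  measurable_fun setT (fun y => \int[mu]_x (f x * k (y, x))).
Proof.
move=> lf mk kC.
have [l _] := fubini_kernel (L1_abel_weight ltr01) lf mk kC.
have := measurable_funM (L1_measurable l)
  (continuous_measurable_fun (@continuous_abel_weight R (-1))).
apply: eq_measurable_fun => y _ /=.
by rewrite mulrAC /abel_weight mulN1r mul1r opprK -expRD addNr expR0 mul1r.
Qed.

Lemma measurable_prod_mul : measurable_fun setT (fun p : R * R => p.1 * p.2).
Proof. by apply: measurable_funM. Qed.

Lemma measurable_cosT f : L1 f -> measurable_fun setT (cosT f).
Proof.
move=> lf; apply: (@measurable_kernel_int _ (fun p => cos (p.1 * p.2)) 1) => //.
  apply: (measurableT_comp _ measurable_prod_mul).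
  by apply: continuous_measurable_fun; exact: continuous_cos.
by move=> p; exact: norm_cos_le1.
Qed.

Lemma measurable_sinT f : L1 f -> measurable_fun setT (sinT f).
Proof.
move=> lf; apply: (@measurable_kernel_int _ (fun p => sin (p.1 * p.2)) 1) => //.
  apply: (measurableT_comp _ measurable_prod_mul).
  by apply: continuous_measurable_fun; exact: continuous_sin.
by move=> p; exact: norm_sin_le1.
Qed.

Lemma cosTN f y : cosT f (- y) = cosT f y.
Proof. by apply: int_eq => x; rewrite mulNr cosN. Qed.

Lemma sinTN f y : L1 f -> sinT f (- y) = - sinT f y.
Proof.
move=> lf; rewrite -[RHS]mulN1r sinTZ//.
by apply: int_eq => x; rewrite mulNr sinN mulN1r mulrN.
Qed.

Lemma poisson_ge0 e z : 0 < e -> 0 <= poisson e z.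
Proof.
move=> e0; rewrite /poisson divr_ge0// ?mulr_ge0 ?(ltW e0)//.
by rewrite addr_ge0 ?sqr_ge0.
Qed.

Lemma norm_poisson_le e z : 0 < e -> `|poisson e z| <= 2 / e.
Proof.
move=> e0; rewrite ger0_norm ?poisson_ge0// /poisson.
rewrite ler_pdivrMr; last by rewrite ltr_pwDl ?sqr_ge0// exprn_gt0.
have -> : 2 * e = 2 / e * e ^+ 2 by field; rewrite gt_eqF.
by rewrite ler_wpM2l ?divr_ge0 ?(ltW e0)// lerDl sqr_ge0.
Qed.

Lemma poissonN e z : poisson e (- z) = poisson e z.
Proof. by rewrite /poisson sqrrN. Qed.

Lemma continuous_poisson e : 0 < e -> continuous (poisson e).
Proof.
move=> e0 z.
have h : derivable (fun z : R => 2 * e * (e ^+ 2 + z ^+ 2)^-1) z 1.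
  have ez : e ^+ 2 + z ^+ 2 != 0.
    by rewrite gt_eqF// ltr_pwDl ?sqr_ge0// exprn_gt0.
  by apply: ex_derive.
by apply: differentiable_continuous; apply/derivable1_diffP.
Qed.

Lemma measurable_poissonB e : 0 < e ->
  measurable_fun setT (fun p : R * R => poisson e (p.1 - p.2)).
Proof.
move=> e0; apply: (@measurableT_comp _ _ _ _ _ _ (poisson e)).
  by apply: continuous_measurable_fun; exact: continuous_poisson.
exact: measurable_funB.
Qed.

(** On the left stands the real part of [f^] times the conjugate of [g^]. The transforms are
    unfolded one at a time, so that each exchange pairs integrable functions with a bounded kernel;
    the addition formula merges them into [cos (v (s - t))], whose weighted integral in [v] is the
    Poisson kernel. *)
Lemma poisson_identity e f g : 0 < e -> L1 f -> L1 g ->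
  \int[mu]_v (abel_weight e v * (cosT f v * cosT g v + sinT f v * sinT g v)) =
  \int[mu]_s (f s * \int[mu]_t (g t * poisson e (s - t))).
Proof.
move=> e0 lf lg; have lw := L1_abel_weight e0.
pose K (p : R * R) := cosT g p.1 * cos (p.1 * p.2) + sinT g p.1 * sin (p.1 * p.2).
have mK : measurable_fun setT K.
  apply: measurable_funD; apply: measurable_funM.
  - by apply: measurableT_comp => //; exact: measurable_cosT.
  - apply: (measurableT_comp _ measurable_prod_mul).
    by apply: continuous_measurable_fun; exact: continuous_cos.
  - by apply: measurableT_comp => //; exact: measurable_sinT.
  - apply: (measurableT_comp _ measurable_prod_mul).
    by apply: continuous_measurable_fun; exact: continuous_sin.
have bK p : `|K p| <= (\int[mu]_x `|g x|) *+ 2.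
  rewrite mulr2n (le_trans (ler_normD _ _))// lerD// normrM.
    by rewrite (le_trans _ (norm_cosT_le p.1 lg))// ler_piMr// norm_cos_le1.
  by rewrite (le_trans _ (norm_sinT_le p.1 lg))// ler_piMr// norm_sin_le1.
transitivity (\int[mu]_v (abel_weight e v * \int[mu]_s (f s * K (v, s)))).
  apply: int_eq => v; congr (_ * _); rewrite mulrC (mulrC (sinT f v)).
  rewrite cosTZ// sinTZ//.
  rewrite -intD; [|exact/L1Z/L1_cosM|exact/L1Z/L1_sinM].
  by apply: int_eq => s; rewrite /K/=; ring.
have [_ ->] := fubini_kernel lw lf mK bK.
apply: int_eq => s; congr (_ * _).
transitivity (\int[mu]_v (abel_weight e v * \int[mu]_t (g t * cos (v * (s - t))))).
  apply: int_eq => v; congr (_ * _); rewrite /K/= mulrC (mulrC (sinT g v)).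
  rewrite cosTZ// sinTZ//.
  rewrite -intD; [|exact/L1Z/L1_cosM|exact/L1Z/L1_sinM].
  by apply: int_eq => t; rewrite mulrBr cosB; ring.
have mk : measurable_fun setT (fun p : R * R => cos (p.1 * (s - p.2))).
  apply: (@measurableT_comp _ _ _ _ _ _ cos).
    by apply: continuous_measurable_fun; exact: continuous_cos.
  by apply: measurable_funM => //; exact: measurable_funB.
have [_ /= ->] := fubini_kernel lw lg mk (fun p => norm_cos_le1 _).
apply: int_eq => t; congr (_ * _).
by rewrite -int_abel_weight_cos//; apply: int_eq => v; rewrite (mulrC v).
Qed.

Lemma int_indic_itv x y f :
  \int[mu]_t (\1_`[x, y] t * f t) = \int[mu]_(t in `[x, y]) f t.
Proof.
rewrite [RHS]Rintegral_mkcond; apply: int_eq => t.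
by rewrite indicE patchE; case: ifPn; rewrite ?mul1r ?mul0r.
Qed.

Lemma int_poisson_itv e s x y : 0 < e -> x < y ->
  \int[mu]_t (\1_`[x, y] t * poisson e (s - t)) =
  2 * (atan ((y - s) / e) - atan ((x - s) / e)).
Proof.
move=> e0 xy; rewrite int_indic_itv.
have d (t : R) : is_derive t 1 (fun t : R => 2 * atan ((t - s) / e)) (poisson e (s - t)).
  apply: is_derive_eq; rewrite /GRing.scale/= /poisson; field.
  by rewrite !gt_eqF// ltr_pwDl ?sqr_ge0// exprn_gt0.
have cF : continuous (fun t : R => 2 * atan ((t - s) / e)).
  move=> t; apply: differentiable_continuous; apply/derivable1_diffP.
  by have [] := d t.
have c : continuous (fun t : R => poisson e (s - t)).
  move=> t; have c1 : {for t, continuous (fun t : R => s - t)}.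
    by apply: continuousB; [exact: cvg_cst|exact: cvg_id].
  exact: (continuous_comp c1 (@continuous_poisson _ e0 _)).
rewrite /Rintegral (@continuous_FTC2 _ _ (fun t : R => 2 * atan ((t - s) / e)))//=.
- by rewrite mulrBr.
- exact: continuous_subspaceT.
- split.
  + by move=> t _; have [] := d t.
  + by apply: cvg_at_right_filter; exact: cF.
  + by apply: cvg_at_left_filter; exact: cF.
- by move=> t _; rewrite derive1E; have [] := d t.
Qed.

End Transform.

(** * Bessel's inequality and Parseval's identity *)

Section Bessel.
Context {R : realType}.
Local Notation mu := (@lebesgue_measure R).
Implicit Types (e z x y : R) (f g h : R -> R).

Lemma dominated_int (f_ : nat -> R -> R) f g :
  (forall n, measurable_fun setT (f_ n)) ->
  (forall x, f_ n x @[n --> \oo] --> f x) ->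
  L1 g -> (forall n x, `|f_ n x| <= g x) ->
  L1 f /\ \int[mu]_x f_ n x @[n --> \oo] --> \int[mu]_x f x.
Proof.
move=> mf ff lg fg.
have mf' n : measurable_fun setT (fun x => (f_ n x)%:E) by exact/measurable_EFinP.
have ff' x : [set: R] x -> (f_ n x)%:E @[n --> \oo] --> (f x)%:E.
  by move=> _; apply: cvg_EFin; [exact: nearW|exact: ff].
have mlim : measurable_fun setT (fun x => (f x)%:E).
  by apply: (emeasurable_fun_cvg (fun n x => (f_ n x)%:E)) => // x Dx; exact: ff'.
have fg' : {ae mu, forall x n, [set: R] x -> (`|(f_ n x)%:E| <= (EFin \o g) x)%E}.
  by apply: aeW => x n _; rewrite /= lee_fin.
have := @dominated_convergence _ _ _ mu _ measurableT
  (fun n x => (f_ n x)%:E) (fun x => (f x)%:E) (EFin \o g) mf' mlim.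
move=> /(_ _ lg fg')[]; first by apply: aeW => x; exact: ff'.
move=> l _ cv.
split; first exact: l.
by apply: fine_cvg; rewrite -int_EFin//; exact: cv.
Qed.

(** Monotone convergence used to remove a weight: integrability of [h] is not known beforehand and
    comes from the uniform bound. *)
Lemma monotone_int_bound (w : nat -> R -> R) h (C : R) :
  (forall n x, 0 <= w n x) -> (forall x, {homo w ^~ x : n m / (n <= m)%N >-> n <= m}) ->
  (forall x, w n x @[n --> \oo] --> (1 : R)) ->
  measurable_fun setT h -> (forall x, 0 <= h x) ->
  (forall n, L1 (fun x => w n x * h x)) ->
  (forall n, \int[mu]_x (w n x * h x) <= C) ->
  L1 h /\ \int[mu]_x h x <= C.
Proof.
move=> w0 wi w1 mh h0 lwh wC.
have le : (\int[mu]_x (h x)%:E <= C%:E)%E.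
  have -> : (\int[mu]_x (h x)%:E = \int[mu]_x (limn (fun n => (w n x * h x)%:E)))%E.
    apply: eq_integral => x _; apply/esym/cvg_lim => //.
    apply: cvg_EFin; first exact: nearW.
    by rewrite -[X in _ --> X]mul1r; apply: cvgMl; exact: w1.
  have := @cvg_monotone_convergence _ _ _ mu setT measurableT
    (fun n x => (w n x * h x)%:E).
  move=> cv; apply: (cvge_le _ (cv _ _ _)).
  - by apply: nearW => n; rewrite int_EFin ?lee_fin.
  - by move=> n; exact: measurable_int (lwh n).
  - by move=> n x _; rewrite lee_fin mulr_ge0.
  - by move=> x _ n m nm; rewrite lee_fin ler_wpM2r// wi.
have l : L1 h.
  apply/integrableP; split; first exact/measurable_EFinP.
  under eq_integral => x _ do rewrite gee0_abs ?lee_fin//.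
  by rewrite (le_lt_trans le)// ltry.
by split=> //; rewrite -lee_fin -int_EFin.
Qed.

(** With [e = 1 / (n + 1)] the weights increase to 1 along a sequence, so both monotone and
    dominated convergence apply. *)
Let weight (n : nat) x : R := abel_weight n.+1%:R^-1 x.

Let weight_gt0 n : 0 < n.+1%:R^-1 :> R.
Proof. by rewrite invr_gt0 ltr0n. Qed.

Lemma abel_weight_ge0 e x : 0 <= abel_weight e x.
Proof. exact: expR_ge0. Qed.

Lemma norm_abel_weight_le1 e x : 0 <= e -> `|abel_weight e x| <= 1.
Proof.
move=> e0; rewrite ger0_norm ?abel_weight_ge0// -expR0 ler_expR.
by rewrite oppr_le0 mulr_ge0.
Qed.

Let weight_homo x : {homo weight ^~ x : n m / (n <= m)%N >-> n <= m}.
Proof.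
move=> n m nm; rewrite ler_expR lerN2 ler_wpM2r//.
by rewrite lef_pV2 ?posrE ?ltr0n// ler_nat.
Qed.

Let cvg_weight x : weight n x @[n --> \oo] --> (1 : R).
Proof.
rewrite -(@expR0 R); apply: continuous_cvg; first exact: continuous_expR.
rewrite -oppr0; apply: cvgN; rewrite -(mul0r `|x|); apply: cvgMl.
exact: cvg_harmonic.
Qed.

Definition poisson_form e f g := \int[mu]_s (f s * \int[mu]_t (g t * poisson e (s - t))).

Let norm_poissonB e : 0 < e -> forall p : R * R, `|poisson e (p.1 - p.2)| <= 2 / e.
Proof. by move=> e0 p; exact: norm_poisson_le. Qed.

Lemma L1_poissonM e f s : 0 < e -> L1 f -> L1 (fun t => f t * poisson e (s - t)).
Proof.
move=> e0 lf; apply: (@L1Mb _ _ _ (2 / e)) => //.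
  exact: (measurableT_comp (measurable_poissonB e0) (measurable_pair1 s)).
by move=> t; exact: norm_poisson_le.
Qed.

Lemma L1_poisson_form e f g : 0 < e -> L1 f -> L1 g ->
  L1 (fun s => f s * \int[mu]_t (g t * poisson e (s - t))).
Proof.
move=> e0 lf lg.
by have [] := fubini_kernel lf lg (measurable_poissonB e0) (norm_poissonB e0).
Qed.

Lemma poisson_formC e f g : 0 < e -> L1 f -> L1 g ->
  poisson_form e f g = poisson_form e g f.
Proof.
move=> e0 lf lg.
have [_ /= h] := fubini_kernel lf lg (measurable_poissonB e0) (norm_poissonB e0).
rewrite /poisson_form h.
apply: int_eq => t; congr (_ * _); apply: int_eq => s /=.
by rewrite -poissonN opprB.
Qed.

(** The kernel has mass at most [2 pi] on any interval, since arctangents stay in []-pi/2,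
    pi/2[]. *)
Lemma poisson_form_indic_le e f x y : 0 < e -> x < y -> L1 f ->
  (forall s, 0 <= f s) ->
  poisson_form e f (\1_`[x, y]) <= 2 * pi * \int[mu]_s f s.
Proof.
move=> e0 xy lf f0; rewrite -intZ//; apply: int_le; last 2 first.
- exact: L1Z.
- move=> s; rewrite int_poisson_itv// mulrC ler_wpM2r//.
  rewrite ler_wpM2l// lerBlDr.
  have := @atan_ltpi2 R ((y - s) / e); have := @atan_gtNpi2 R ((x - s) / e).
  by move=> h1 h2; lra.
- apply: L1_poisson_form => //; exact: L1_indic.
Qed.

Lemma bessel_weighted e f M : 0 < e -> L2 f -> (forall x, M < `|x| -> f x = 0) ->
  \int[mu]_v (abel_weight e v * (cosT f v ^+ 2 + sinT f v ^+ 2)) <=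
  2 * pi * \int[mu]_x (f x ^+ 2).
Proof.
move=> e0 lf fM; have l1f := L2_L1 lf fM.
have := poisson_identity e0 l1f l1f.
under int_eq do rewrite -!expr2.
(* AM-GM: [2 f(s) f(t) <= f(s)^2 i(t) + i(s) f(t)^2], with [i] the indicator of
   an interval carrying [f]. *)
move=> ->; pose N : R := `|M| + 1; pose i : R -> R := \1_`[-N, N].
have li : L1 i by exact: L1_indic.
have l2f := lf.2.
(* [N] exceeds [|M|], so the interval is nondegenerate and carries [f] whatever the sign of [M]. *)
have N0 : - N < N by rewrite gtrN// ltr_pwDr.
apply: (le_trans _ (poisson_form_indic_le e0 N0 l2f (fun s => sqr_ge0 _))).
(* Symmetry of the form supplies the two halves that the AM-GM bound produces. *)
have -> : poisson_form e (fun x => f x ^+ 2) i =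
    2^-1 * (poisson_form e (fun x => f x ^+ 2) i + poisson_form e i (fun x => f x ^+ 2)).
  by rewrite -(poisson_formC e0 l2f li); field.
rewrite -intD; [|exact: L1_poisson_form|exact: L1_poisson_form].
rewrite -intZ; last by apply: L1D; exact: L1_poisson_form.
apply: int_le; first exact: L1_poisson_form.
  by apply: L1Z; apply: L1D; exact: L1_poisson_form.
move=> s; rewrite -!intZ; [|exact: L1_poissonM..].
rewrite -intD; [|exact/L1Z/L1_poissonM|exact/L1Z/L1_poissonM].
rewrite -intZ; last by apply: L1D; exact/L1Z/L1_poissonM.
apply: int_le; first exact/L1Z/L1_poissonM.
  by apply: L1Z; apply: L1D; exact/L1Z/L1_poissonM.
move=> t; set k := poisson e (s - t); have k0 : 0 <= k by exact: poisson_ge0.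
have -> : 2^-1 * (f s ^+ 2 * (i t * k) + i s * (f t ^+ 2 * k)) =
    2^-1 * (f s ^+ 2 * i t + i s * f t ^+ 2) * k by ring.
rewrite mulrA ler_wpM2r//.
have iE z : f z != 0 -> i z = 1.
  move=> fz; rewrite /i indicE mem_setE in_itv/= -ler_norml.
  rewrite (_ : _ <= _)// leNgt; apply/negP => Nz.
  move/eqP : fz; apply; apply: fM; rewrite (le_lt_trans _ Nz)// /N.
  by rewrite (le_trans (ler_norm M))// lerDl.
have i0 z : 0 <= i z by rewrite /i indicE.
have [->|fs] := eqVneq (f s) 0.
  by rewrite mul0r !expr0n/= mul0r add0r mulr_ge0// mulr_ge0// sqr_ge0.
have [->|ft] := eqVneq (f t) 0.
  by rewrite mulr0 !expr0n/= mulr0 addr0 mulr_ge0// mulr_ge0// sqr_ge0.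
rewrite !iE// mulr1 mul1r.
have := sqr_ge0 (f s - f t); nra.
Qed.

Lemma bessel f M : L2 f -> (forall x, M < `|x| -> f x = 0) ->
  L1 (fun v => cosT f v ^+ 2 + sinT f v ^+ 2) /\
  \int[mu]_v (cosT f v ^+ 2 + sinT f v ^+ 2) <= 2 * pi * \int[mu]_x (f x ^+ 2).
Proof.
move=> lf fM; have l1f := L2_L1 lf fM.
have mcs : measurable_fun setT (fun v => cosT f v ^+ 2 + sinT f v ^+ 2).
  apply: measurable_funD; apply: measurable_funX; first exact: measurable_cosT.
  exact: measurable_sinT.
apply: (@monotone_int_bound weight) => //.
- by move=> n x; exact: abel_weight_ge0.
- by move=> x; rewrite addr_ge0 ?sqr_ge0.
(* For a fixed weight it suffices that the transforms are bounded, by the L^1 norm [A] of [f]. *)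
- move=> n; set A := \int[mu]_x `|f x|.
  apply: (@L1Mb _ _ _ (A ^+ 2 + A ^+ 2)) => //; first exact: L1_abel_weight.
  move=> x; have A0 : 0 <= A by apply: Rintegral_ge0.
  rewrite ger0_norm ?addr_ge0 ?sqr_ge0// lerD//.
  + by rewrite -(real_normK (num_real (cosT f x))) lerXn2r ?nnegrE// norm_cosT_le.
  + by rewrite -(real_normK (num_real (sinT f x))) lerXn2r ?nnegrE// norm_sinT_le.
- by move=> n; exact: bessel_weighted (weight_gt0 n) lf fM.
Qed.

Lemma L2_cosT f M : L2 f -> (forall x, M < `|x| -> f x = 0) -> L2 (cosT f).
Proof.
move=> lf fM; have [l _] := bessel lf fM; have l1f := L2_L1 lf fM.
have mc := measurable_cosT l1f; split=> //.
apply: L1_le l; first exact: measurable_funX.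
by move=> x; rewrite ger0_norm ?sqr_ge0// lerDl sqr_ge0.
Qed.

Lemma L2_sinT f M : L2 f -> (forall x, M < `|x| -> f x = 0) -> L2 (sinT f).
Proof.
move=> lf fM; have [l _] := bessel lf fM; have l1f := L2_L1 lf fM.
have mc := measurable_sinT l1f; split=> //.
apply: L1_le l; first exact: measurable_funX.
by move=> x; rewrite ger0_norm ?sqr_ge0// lerDr sqr_ge0.
Qed.

(** As [e] tends to 0 the arctangents become signs. Including [a = 0] gives convergence at every
    point, not just almost everywhere. *)
Lemma cvg_atan_scale (a : R) :
  atan (a / n.+1%:R^-1) @[n --> \oo] --> Num.sg a * (pi / 2).
Proof.
have pos (b : R) : 0 < b -> atan (b / n.+1%:R^-1) @[n --> \oo] --> pi / 2.
  move=> b0; under eq_fun do rewrite invrK.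
  have g : atan (b * x) @[x --> +oo] --> pi / 2.
    by apply: cvg_comp (@cvgy_atan R); apply: gt0_cvgMry b0 _; exact: cvg_id.
  have h : (n.+1%:R : R) @[n --> \oo] --> +oo.
    by rewrite (cvg_shiftS (fun n => n%:R : R)); exact: cvgr_idn.
  exact: (cvg_comp _ _ h g).
have [a0|a0|->] := ltgtP a 0.
- rewrite ltr0_sg// mulN1r.
  rewrite (_ : (fun _ => _) = (fun n => - atan (- a / n.+1%:R^-1))).
    by apply: cvgN; apply: pos; rewrite oppr_gt0.
  by apply/funext => n; rewrite mulNr atanN opprK.
- by rewrite gtr0_sg// mul1r; exact: pos.
- by rewrite sgr0 mul0r; under eq_fun do rewrite mul0r atan0; exact: cvg_cst.
Qed.

Lemma int_set1 f x : \int[mu]_t (f t * \1_`[x, x] t) = 0.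
Proof.
under int_eq do rewrite mulrC.
by rewrite int_indic_itv set_itv1 Rintegral_set1.
Qed.

Lemma L2T_indic x y : L2 (cosT \1_`[x, y]) /\ L2 (sinT \1_`[x, y]).
Proof.
set i := \1_`[x, y] : R -> R.
have l2i : L2 i by exact: L2_indic.
pose N : R := `|x| + `|y|.
have iN t : N < `|t| -> i t = 0.
  move=> Nt; rewrite /i indicE mem_setE in_itv/=.
  apply/eqP; rewrite pnatr_eq0 eqb0; apply/negP => /andP[xt ty].
  move: Nt; rewrite ltNge => /negP; apply; rewrite ler_norml /N.
  have := lerNnormlW (lexx `|x|); have := ler_norm y.
  have := normr_ge0 x; have := normr_ge0 y; lra.
by split; [exact: (L2_cosT l2i iN)|exact: (L2_sinT l2i iN)].
Qed.

(** Both sides of the Poisson identity pass to the limit by dominated convergence: the left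
    integrand is dominated by the product [h], integrable by Bessel, and on the right the integral
    of the kernel over [[x, y]] is bounded by [2 pi]. *)
Lemma parseval_indic f M x y : x < y -> L2 f -> (forall t, M < `|t| -> f t = 0) ->
  \int[mu]_v (cosT f v * cosT \1_`[x, y] v + sinT f v * sinT \1_`[x, y] v) =
  2 * pi * \int[mu]_t (\1_`[x, y] t * f t).
Proof.
move=> xy lf fM; have l1f := L2_L1 lf fM.
set i := \1_`[x, y] : R -> R.
have l2i : L2 i by exact: L2_indic.
have l1i : L1 i by exact: L1_indic.
have [lci lsi] := L2T_indic x y.
pose h v := cosT f v * cosT i v + sinT f v * sinT i v.
have lh : L1 h.
  apply: L1D; apply: L2_mul => //; first exact: L2_cosT lf fM.
  exact: L2_sinT lf fM.
have [_ cvl] : L1 h /\ \int[mu]_v (weight n v * h v) @[n --> \oo] --> \int[mu]_v h v.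
  apply: (@dominated_int _ _ (fun v => `|h v|)).
  - move=> n; apply: measurable_funM; first exact: measurable_abel_weight.
    exact: L1_measurable.
  - by move=> v; rewrite -[X in _ --> X]mul1r; apply: cvgMl; exact: cvg_weight.
  - exact: L1_norm.
  - by move=> n v; rewrite normrM ler_piMl// norm_abel_weight_le1// invr_ge0.
pose q (n : nat) s : R := 2 * (atan ((y - s) / n.+1%:R^-1) - atan ((x - s) / n.+1%:R^-1)).
pose q' s := pi * (Num.sg (y - s) - Num.sg (x - s)).
have cq s : q n s @[n --> \oo] --> q' s.
  rewrite /q' (_ : pi * _ = 2 * (Num.sg (y - s) * (pi / 2) - Num.sg (x - s) * (pi / 2))).
    by apply: cvgMr; apply: cvgB; exact: cvg_atan_scale.
  by field.
have qE n s : q n s = \int[mu]_t (i t * poisson n.+1%:R^-1 (s - t)).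
  by rewrite int_poisson_itv.
have [_ cvr] : L1 (fun s => f s * q' s) /\
    \int[mu]_s (f s * q n s) @[n --> \oo] --> \int[mu]_s (f s * q' s).
  apply: (@dominated_int _ _ (fun s => 2 * pi * `|f s|)).
  - move=> n; apply: L1_measurable; under eq_fun do rewrite qE.
    exact: L1_poisson_form.
  - by move=> s; apply: cvgMr; exact: cq.
  - exact/L1Z/L1_norm.
  - move=> n s; rewrite normrM mulrC ler_wpM2r// /q ler_norml.
    set u := atan _; set v := atan _.
    have := @atan_ltpi2 R ((y - s) / n.+1%:R^-1).
    have := @atan_gtNpi2 R ((y - s) / n.+1%:R^-1).
    have := @atan_ltpi2 R ((x - s) / n.+1%:R^-1).
    have := @atan_gtNpi2 R ((x - s) / n.+1%:R^-1).
    rewrite -/u -/v => h1 h2 h3 h4; apply/andP; split; lra.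
have -> : \int[mu]_v h v = \int[mu]_s (f s * q' s).
  have eqn : (fun n => \int[mu]_v (weight n v * h v)) = (fun n => \int[mu]_s (f s * q n s)).
    apply/funext => n; rewrite poisson_identity//.
    by apply: int_eq => s; rewrite qE.
  by apply: (@cvg_unique _ (@norm_hausdorff _ R) _ _ _ _ cvl); rewrite eqn.
(* [q'] is [2 pi] inside the interval but only [pi] at its two ends, so the closed indicator
   overshoots by [pi] there. The correction lives on two points and integrates to 0. *)
have E s : f s * q' s = 2 * pi * (i s * f s) +
    (- pi) * (f s * \1_`[x, x] s + f s * \1_`[y, y] s).
  rewrite /q' /i !indicE !mem_setE !in_itv/=.
  have [sx|sx|sx] := ltgtP s x.
  - have sy := lt_trans sx xy.
    by rewrite !gtr0_sg ?subr_gt0//= (lt_geF sy)/=; ring.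
  - have [sy|sy|sy] := ltgtP s y.
    + rewrite gtr0_sg ?subr_gt0// ltr0_sg ?subr_lt0//=; ring.
    + rewrite !ltr0_sg ?subr_lt0//=; ring.
    + rewrite sy subrr sgr0 ltr0_sg ?subr_lt0//=; ring.
  - rewrite sx subrr sgr0 gtr0_sg ?subr_gt0// (ltW xy) (lt_geF xy)/=; ring.
have l1 z : L1 (fun s => f s * \1_`[z, z] s) by apply: L2_mul => //; exact: L2_indic.
rewrite (int_eq E) intD; last 2 first.
- by apply: L1Z; exact: L2_mul.
- by apply: L1Z; exact: L1D.
rewrite intZ; last exact: L2_mul.
rewrite intZ; last exact: L1D.
by rewrite intD// !int_set1 addr0 mulr0 addr0.
Qed.

End Bessel.

(** * Complex-valued functions and the parity of cross terms *)

Section ComplexTransform.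
Context {R : realType}.
Local Notation mu := (@lebesgue_measure R).
Implicit Types (e z x y : R) (f g h p q : R -> R).

Lemma ge0_integral_reflect (g : R -> \bar R) : (forall x, 0 <= g x)%E ->
  measurable_fun setT g ->
  (\int[mu]_x g (- x)%R = \int[mu]_x g x)%E.
Proof.
move=> g0 mg.
have mN : measurable_fun [set: measurableTypeR R] (-%R : _ -> measurableTypeR R) by [].
have := @ge0_integral_pushforward _ _ _ _ R _ mN mu setT g measurableT mg (fun x _ => g0 x).
rewrite preimage_setT => <-.
by apply: eq_measure_integral => A mA _; exact: lebesgue_measureN.
Qed.

(* Real and imaginary parts of the Fourier transform of [p + i q]. *)
Definition reT p q y := cosT p y + sinT q y.
Definition imT p q y := cosT q y - sinT p y.


Lemma L1_reflect h : L1 h -> L1 (fun x => h (- x)).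
Proof.
move=> /integrableP[mh hoo]; apply/integrableP; split.
  by apply/measurable_EFinP; apply: measurableT_comp => //; exact/measurable_EFinP.
rewrite (ge0_integral_reflect (g := fun x => `|(h x)%:E|%E))//.
exact: measurableT_comp.
Qed.

Lemma int_reflect h : L1 h -> \int[mu]_x h (- x) = \int[mu]_x h x.
Proof.
move=> lh; have lh' := L1_norm lh; have mh := L1_measurable lh.
have l0 := L1D lh lh'.
(* Reflection is available for nonnegative functions, so [h] is treated as the difference of
   [h + |h|] and [|h|]. *)
have E : \int[mu]_x (h (- x) + `|h (- x)|) = \int[mu]_x (h x + `|h x|).
  congr fine; apply: (ge0_integral_reflect (g := fun x => (h x + `|h x|)%:E)).
    by move=> x; rewrite lee_fin -lerBlDr sub0r; exact: lerNnormlW.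
  by apply/measurable_EFinP; exact: L1_measurable.
have E' : \int[mu]_x `|h (- x)| = \int[mu]_x `|h x|.
  congr fine; apply: (ge0_integral_reflect (g := fun x => (`|h x|)%:E)) => //.
  by apply/measurable_EFinP; exact: L1_measurable.
move: E; rewrite intD//; last exact: (L1_reflect lh').
  by rewrite intD// E' => /addIr.
exact: L1_reflect.
Qed.

Lemma int_odd h : L1 h -> (forall x, h (- x) = - h x) -> \int[mu]_x h x = 0.
Proof.
move=> lh ho; have := int_reflect lh.
under int_eq do rewrite ho -mulN1r.
rewrite intZ//; lra.
Qed.

Lemma bessel_complex p q M : L2 p -> L2 q ->
  (forall x, M < `|x| -> p x = 0) -> (forall x, M < `|x| -> q x = 0) ->
  L1 (fun v => reT p q v ^+ 2 + imT p q v ^+ 2) /\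
  \int[mu]_v (reT p q v ^+ 2 + imT p q v ^+ 2) <=
    2 * pi * \int[mu]_x (p x ^+ 2 + q x ^+ 2).
Proof.
move=> lp lq pM qM; have [l1 b1] := bessel lp pM; have [l2 b2] := bessel lq qM.
have lcp := L2_cosT lp pM; have lsp := L2_sinT lp pM.
have lcq := L2_cosT lq qM; have lsq := L2_sinT lq qM.
have L1p := L2_L1 lp pM; have L1q := L2_L1 lq qM.
(* The cross terms are odd. *)
pose k v := cosT p v * sinT q v - cosT q v * sinT p v.
have lk : L1 k by apply: L1B; exact: L2_mul.
have k0 : \int[mu]_v k v = 0.
  by apply: int_odd => // x; rewrite /k !cosTN !sinTN//; ring.
have E v : reT p q v ^+ 2 + imT p q v ^+ 2 =
    (cosT p v ^+ 2 + sinT p v ^+ 2 + (cosT q v ^+ 2 + sinT q v ^+ 2)) + 2 * k v.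
  by rewrite /reT /imT /k; ring.
have l12 := L1D l1 l2; have l2k := L1Z 2 lk.
split; first by apply: (L1_eq (L1D l12 l2k)) => v; rewrite E.
rewrite (intD lp.2 lq.2) (int_eq E) intD// intD// intZ// k0 mulr0 addr0.
by rewrite mulrDr lerD.
Qed.

(** The left integrand is the real part of the transform of [p + i q] times the integral of exp(i v
    t) over [[x, y]]. The contribution of [q] is odd in [v], cosine transforms being even and sine
    transforms odd, so only [p] survives. *)
Lemma parseval_indic_complex p q M x y : x < y -> L2 p -> L2 q ->
  (forall t, M < `|t| -> p t = 0) -> (forall t, M < `|t| -> q t = 0) ->
  \int[mu]_v (reT p q v * cosT \1_`[x, y] v - imT p q v * sinT \1_`[x, y] v) =
  2 * pi * \int[mu]_t (\1_`[x, y] t * p t).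
Proof.
move=> xy lp lq pM qM; rewrite -(parseval_indic xy lp pM).
have [lci lsi] := L2T_indic x y.
set i := \1_`[x, y] : R -> R.
have lcp := L2_cosT lp pM; have lsp := L2_sinT lp pM.
have lcq := L2_cosT lq qM; have lsq := L2_sinT lq qM.
have L1p := L2_L1 lp pM; have L1q := L2_L1 lq qM.
have L1i : L1 i := L1_indic x y.
pose k v := sinT q v * cosT i v - cosT q v * sinT i v.
have lk : L1 k by apply: L1B; exact: L2_mul.
have k0 : \int[mu]_v k v = 0.
  by apply: int_odd => // v; rewrite /k !cosTN !sinTN//; ring.
have E v : reT p q v * cosT i v - imT p q v * sinT i v =
    (cosT p v * cosT i v + sinT p v * sinT i v) + k v.
  by rewrite /reT /imT /k; ring.
by rewrite (int_eq E) intD// ?k0 ?addr0//; apply: L1D; exact: L2_mul.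
Qed.

End ComplexTransform.

(** * From truncations to the L^2 Fourier transform *)

Section FourierLimit.
Context {R : realType}.
Local Notation mu := (@lebesgue_measure R).
Implicit Types (e x y A M : R) (f g h p q : R -> R).

Definition trunc A f x := f x * \1_`[- A, A] x.

Lemma L2_trunc A f : L2 f -> L2 (trunc A f).
Proof.
move=> lf; apply: (@L2Mb _ f (\1_`[- A, A]) 1) => //.
by move=> x; rewrite indicE; case: (_ \in _); rewrite ?normr1 ?normr0.
Qed.

Lemma trunc_eq0 A f x : A < `|x| -> trunc A f x = 0.
Proof.
move=> Ax; rewrite /trunc indicE mem_setE in_itv/= -ler_norml.
by rewrite leNgt Ax mulr0.
Qed.

Lemma trunc_sqr_le A f x : trunc A f x ^+ 2 <= f x ^+ 2.
Proof.
rewrite /trunc indicE; case: (_ \in _); rewrite ?mulr1// mulr0 expr0n.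
exact: sqr_ge0.
Qed.

Lemma L2_reT_trunc A f g : L2 f -> L2 g -> L2 (reT (trunc A f) (trunc A g)).
Proof.
move=> lf lg; apply: L2D.
  exact: L2_cosT (L2_trunc A lf) (@trunc_eq0 A f).
exact: L2_sinT (L2_trunc A lg) (@trunc_eq0 A g).
Qed.

Lemma L2_imT_trunc A f g : L2 f -> L2 g -> L2 (imT (trunc A f) (trunc A g)).
Proof.
move=> lf lg; apply: L2B.
  exact: L2_cosT (L2_trunc A lg) (@trunc_eq0 A g).
exact: L2_sinT (L2_trunc A lf) (@trunc_eq0 A f).
Qed.

(** Bessel's inequality for the truncations survives the L^2 limit. The triangle inequality is used
    in squared form with a parameter [d], which avoids roots of integrals. *)
Lemma fourier_norm_le f1 f2 P Q : L2 f1 -> L2 f2 -> L2 P -> L2 Q ->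
  (forall A0 d : R, 0 < d -> exists2 A, A0 <= A &
    \int[mu]_v ((reT (trunc A f1) (trunc A f2) v - P v) ^+ 2 +
               (imT (trunc A f1) (trunc A f2) v - Q v) ^+ 2) <= d) ->
  \int[mu]_v (P v ^+ 2 + Q v ^+ 2) <= 2 * pi * \int[mu]_t (f1 t ^+ 2 + f2 t ^+ 2).
Proof.
move=> lf1 lf2 lP lQ H.
set N := \int[mu]_v (P v ^+ 2 + Q v ^+ 2).
set S := \int[mu]_t (f1 t ^+ 2 + f2 t ^+ 2).
have S0 : 0 <= S by apply: Rintegral_ge0 => x _; rewrite addr_ge0 ?sqr_ge0.
have key (d : R) : 0 < d -> N <= (1 + d) * (2 * pi * S) + (1 + d^-1) * d ^+ 2.
  move=> d0; have [A _ HA] := H 0 (d ^+ 2) (exprn_gt0 _ d0).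
  have lp := L2_trunc A lf1; have lq := L2_trunc A lf2.
  set X := reT _ _ in HA; set Y := imT _ _ in HA.
  have [lXY bXY] := bessel_complex lp lq (@trunc_eq0 A f1) (@trunc_eq0 A f2).
  rewrite -/X -/Y in lXY bXY.
  have lX : L2 X by exact: L2_reT_trunc.
  have lY : L2 Y by exact: L2_imT_trunc.
  have lD : L1 (fun v => (X v - P v) ^+ 2 + (Y v - Q v) ^+ 2).
    by apply: L1D; [exact: (L2B lX lP).2|exact: (L2B lY lQ).2].
  have bS : \int[mu]_v (X v ^+ 2 + Y v ^+ 2) <= 2 * pi * S.
    apply: (le_trans bXY); rewrite ler_wpM2l ?mulr_ge0 ?pi_ge0//.
    apply: int_le.
    - by apply: L1D; [exact: lp.2|exact: lq.2].
    - by apply: L1D; [exact: lf1.2|exact: lf2.2].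
    - by move=> x; rewrite lerD// trunc_sqr_le.
  apply: (@le_trans _ _ (\int[mu]_v ((1 + d) * (X v ^+ 2 + Y v ^+ 2) +
      (1 + d^-1) * ((X v - P v) ^+ 2 + (Y v - Q v) ^+ 2)))).
    apply: int_le.
    - by apply: L1D; [exact: lP.2|exact: lQ.2].
    - by apply: L1D; exact: L1Z.
    (* The coefficient of [a ^+ 2] tends to 1 with [d]; this keeps the constant sharp in the
       limit. *)
    - have B (a b : R) : b ^+ 2 <= (1 + d) * a ^+ 2 + (1 + d^-1) * (a - b) ^+ 2.
        rewrite -subr_ge0 (_ : _ - _ = d^-1 * (d * a + (a - b)) ^+ 2).
          by rewrite mulr_ge0 ?sqr_ge0// invr_ge0 ltW.
        by field; rewrite gt_eqF.
      by move=> v; have := B (X v) (P v); have := B (Y v) (Q v); nra.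
  rewrite intD; [|exact: L1Z|exact: L1Z].
  rewrite intZ// intZ// lerD// ler_wpM2l//.
    by rewrite addr_ge0 ?(ltW d0).
  by rewrite addr_ge0 ?invr_ge0 ?(ltW d0).
apply/ler_addgt0Pr => e e0; set B := 2 * pi * S.
have B0 : 0 <= B by rewrite !mulr_ge0 ?pi_ge0.
(* The excess over [B] in [key] is [d B + d^2 + d], at most [d (B + 2)] once [d <= 1]. *)
pose d := Num.min 1 (e / (B + 2)).
have d0 : 0 < d by rewrite lt_min ltr01 divr_gt0//; lra.
have d1 : d <= 1 by rewrite ge_min lexx.
have de : d * (B + 2) <= e.
  by rewrite -ler_pdivlMr ?ge_min ?lexx ?orbT//; lra.
apply: (le_trans (key d d0)); rewrite -/B.
have -> : (1 + d^-1) * d ^+ 2 = d ^+ 2 + d by field; rewrite gt_eqF.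
nra.
Qed.

(** The transforms of the indicator are square integrable, so a small L^2 error in the transform of
    the data causes a small error in the pairing. *)
Lemma fourier_indic f1 f2 P Q x y : L2 f1 -> L2 f2 -> L2 P -> L2 Q ->
  (forall A0 d : R, 0 < d -> exists2 A, A0 <= A &
    \int[mu]_v ((reT (trunc A f1) (trunc A f2) v - P v) ^+ 2 +
               (imT (trunc A f1) (trunc A f2) v - Q v) ^+ 2) <= d) ->
  x < y ->
  \int[mu]_v (P v * cosT \1_`[x, y] v - Q v * sinT \1_`[x, y] v) =
  2 * pi * \int[mu]_t (\1_`[x, y] t * f1 t).
Proof.
move=> lf1 lf2 lP lQ H xy.
have [lc ls] := L2T_indic x y.
set c := cosT _ in lc *; set s := sinT _ in ls *.
pose K := \int[mu]_v (c v ^+ 2 + s v ^+ 2).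
have K0 : 0 <= K by apply: Rintegral_ge0 => v _; rewrite addr_ge0 ?sqr_ge0.
set L := LHS; set r := RHS.
have key (d : R) : 0 < d -> `|r - L| <= d * (1 + K).
  (* Taking [A] beyond [|x| + |y|] keeps [[x, y]] inside the truncation, so the truncated identity
     already has right side [r]. The squared error is [d ^+ 2] because it comes back multiplied by
     [d^-1]. *)
  move=> d0; have [A A0 HA] := H (`|x| + `|y|) (d ^+ 2) (exprn_gt0 _ d0).
  have lp := L2_trunc A lf1; have lq := L2_trunc A lf2.
  set X := reT _ _ in HA; set Y := imT _ _ in HA.
  have lX : L2 X by exact: L2_reT_trunc.
  have lY : L2 Y by exact: L2_imT_trunc.
  have lXP := L2B lX lP; have lYQ := L2B lY lQ.
  have lD : L1 (fun v => (X v - P v) ^+ 2 + (Y v - Q v) ^+ 2).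
    by apply: L1D; [exact: lXP.2|exact: lYQ.2].
  have lC : L1 (fun v => c v ^+ 2 + s v ^+ 2).
    by apply: L1D; [exact: lc.2|exact: ls.2].
  have -> : r = \int[mu]_v (X v * c v - Y v * s v).
    rewrite (parseval_indic_complex xy lp lq (@trunc_eq0 A f1) (@trunc_eq0 A f2)).
    congr (_ * _); apply: int_eq => t.
    rewrite /trunc !indicE !mem_setE !in_itv/=.
    have [/andP[xt ty]|_] := boolP (x <= t <= y); last by rewrite !mul0r.
    rewrite -ler_norml (_ : _ <= _) ?mulr1// (le_trans _ A0)// ler_norml.
    have := lerNnormlW (lexx `|x|); have := ler_norm y.
    have := normr_ge0 x; have := normr_ge0 y; move=> h1 h2 h3 h4.
    by apply/andP; split; lra.
  rewrite -intB; last 2 first.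
  - by apply: L1B; exact: L2_mul.
  - by apply: L1B; exact: L2_mul.
  apply: (@le_trans _ _ (\int[mu]_v (d^-1 * ((X v - P v) ^+ 2 + (Y v - Q v) ^+ 2) +
      d * (c v ^+ 2 + s v ^+ 2)))).
    apply: int_abs_le.
    - by apply: L1D; exact: L1Z.
    - by apply: L1_measurable; apply: L1B; apply: L1B; exact: L2_mul.
    - have B (a b : R) : `|a * b| <= d^-1 * a ^+ 2 + d * b ^+ 2.
        rewrite ler_norml; apply/andP; split; rewrite -subr_ge0.
          rewrite (_ : _ - _ = d^-1 * ((a + d * b) ^+ 2 + a ^+ 2 + (d * b) ^+ 2) / 2).
            by rewrite divr_ge0// mulr_ge0 ?invr_ge0 ?(ltW d0)// !addr_ge0 ?sqr_ge0.
          by field; rewrite gt_eqF.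
        rewrite (_ : _ - _ = d^-1 * ((a - d * b) ^+ 2 + a ^+ 2 + (d * b) ^+ 2) / 2).
          by rewrite divr_ge0// mulr_ge0 ?invr_ge0 ?(ltW d0)// !addr_ge0 ?sqr_ge0.
        by field; rewrite gt_eqF.
      move=> v.
      have -> : X v * c v - Y v * s v - (P v * c v - Q v * s v) =
          (X v - P v) * c v - (Y v - Q v) * s v by ring.
      rewrite (le_trans (ler_normB _ _))//.
      have := B (X v - P v) (c v); have := B (Y v - Q v) (s v); lra.
  rewrite intD; [|exact: L1Z|exact: L1Z].
  rewrite intZ// intZ// -/K mulrDr mulr1 lerD2r.
  rewrite -[leRHS](_ : d^-1 * d ^+ 2 = d); last by field; rewrite gt_eqF.
  by rewrite ler_wpM2l// invr_ge0 ltW.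
suff : `|r - L| <= 0 by rewrite normr_le0 subr_eq0 => /eqP.
apply/ler_addgt0Pr => e e0; rewrite add0r.
have K1 : 0 < 1 + K by rewrite ltr_pwDl.
apply: (le_trans (key (e / (1 + K)) _)); first exact: divr_gt0.
by rewrite divfK// gt_eqF.
Qed.

End FourierLimit.

(** * The inverse transform of a band-limited function *)

Section InverseTransform.
Context {R : realType}.
Local Notation mu := (@lebesgue_measure R).
Implicit Types (e x y A M : R) (f g h p q : R -> R).

(** Differentiation under the integral sign. The dominating function [|x f x|] does not depend on
    the parameter, so any window around [y] would do. *)
Lemma is_derive_cosT f y : L1 f -> L1 (fun x => x * f x) ->
  is_derive y 1 (cosT f) (- sinT (fun x => x * f x) y).
Proof.
move=> lf lxf.
pose k (y x : R) : R := f x * cos (y * x).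
have dk (x z : R) : is_derive z 1 (k ^~ x) (- (x * f x * sin (z * x))).
  rewrite /k; apply: is_derive_eq; rewrite /GRing.scale/=; ring.
have pk (z x : R) : partial1of2 k z x = - (x * f x * sin (z * x)).
  by rewrite partial1of2E; have [_ ->] := dk x z.
have Iy : `]y - 1, y + 1[%classic y.
  by rewrite /= in_itv/= ltrBlDr ltrDl ltr01.
have i1 x : `]y - 1, y + 1[%classic x -> mu.-integrable setT (EFin \o k x).
  by move=> _; exact: L1_cosM.
have i2 (x z : R) : `]y - 1, y + 1[%classic x -> [set: R] z -> derivable (k ^~ z) x 1.
  by move=> _ _; have [] := dk z x.
have i3 (x : R) : 0 <= `|x * f x| by [].
have i4 : mu.-integrable setT (EFin \o (fun x => `|x * f x|)) by exact: L1_norm.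
have i5 (z x : R) : `]y - 1, y + 1[%classic z -> [set: R] x ->
    `|partial1of2 k z x| <= `|x * f x|.
  move=> _ _; rewrite pk normrN normrM ler_piMr//; exact: norm_sin_le1.
have := derivable_under_integral measurableT Iy i1 i2 i3 i4 i5.
have := differentiation_under_integral measurableT Iy i1 i2 i3 i4 i5.
rewrite derive1E => D d; apply: DeriveDef; first exact: d.
rewrite [LHS]D -mulN1r sinTZ//.
by apply: int_eq => x; rewrite pk mulN1r.
Qed.

Lemma is_derive_sinT f y : L1 f -> L1 (fun x => x * f x) ->
  is_derive y 1 (sinT f) (cosT (fun x => x * f x) y).
Proof.
move=> lf lxf.
pose k (y x : R) : R := f x * sin (y * x).
have dk (x z : R) : is_derive z 1 (k ^~ x) (x * f x * cos (z * x)).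
  rewrite /k; apply: is_derive_eq; rewrite /GRing.scale/=; ring.
have pk (z x : R) : partial1of2 k z x = x * f x * cos (z * x).
  by rewrite partial1of2E; have [_ ->] := dk x z.
have Iy : `]y - 1, y + 1[%classic y.
  by rewrite /= in_itv/= ltrBlDr ltrDl ltr01.
have i1 x : `]y - 1, y + 1[%classic x -> mu.-integrable setT (EFin \o k x).
  by move=> _; exact: L1_sinM.
have i2 (x z : R) : `]y - 1, y + 1[%classic x -> [set: R] z -> derivable (k ^~ z) x 1.
  by move=> _ _; have [] := dk z x.
have i3 (x : R) : 0 <= `|x * f x| by [].
have i4 : mu.-integrable setT (EFin \o (fun x => `|x * f x|)) by exact: L1_norm.
have i5 (z x : R) : `]y - 1, y + 1[%classic z -> [set: R] x ->
    `|partial1of2 k z x| <= `|x * f x|.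
  move=> _ _; rewrite pk normrM ler_piMr//; exact: norm_cos_le1.
have := derivable_under_integral measurableT Iy i1 i2 i3 i4 i5.
have := differentiation_under_integral measurableT Iy i1 i2 i3 i4 i5.
rewrite derive1E => D d; apply: DeriveDef; first exact: d.
by rewrite [LHS]D; apply: int_eq => x; rewrite pk.
Qed.

(** Unlike L^2 itself, this class is stable under multiplication by [x], so derivatives of inverse
    transforms stay of the same form at every order. *)
Definition L2b M f := L2 f /\ forall x, M < `|x| -> f x = 0.

Lemma L2b_L1 M f : L2b M f -> L1 f.
Proof. by case=> lf fM; exact: L2_L1 lf fM. Qed.

Lemma L2bD M f g : L2b M f -> L2b M g -> L2b M (fun x => f x + g x).
Proof.
move=> [lf fM] [lg gM]; split; first exact: L2D.
by move=> x Mx; rewrite fM// gM// addr0.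
Qed.

Lemma L2bZ M c f : L2b M f -> L2b M (fun x => c * f x).
Proof.
move=> [lf fM]; split; first exact: L2Z.
by move=> x Mx; rewrite fM// mulr0.
Qed.

Lemma L2bX M f : L2b M f -> L2b M (fun x => x * f x).
Proof.
move=> [lf fM]; split; last by move=> x Mx; rewrite fM// mulr0.
split; first by apply: measurable_funM => //; exact: lf.1.
apply: (@L1_le _ _ (fun x => M ^+ 2 * f x ^+ 2)).
- by apply: measurable_funX; apply: measurable_funM => //; exact: lf.1.
- move=> x; rewrite ger0_norm ?sqr_ge0// exprMn.
  have [xM|/fM ->] := leP `|x| M; last by rewrite expr0n !mulr0.
  rewrite ler_wpM2r ?sqr_ge0// -(real_normK (num_real x)) lerXn2r// nnegrE//.
  by rewrite (le_trans _ xM).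
- by apply: L1Z; exact: lf.2.
Qed.

(* Real part of the integral of [(p + i q)(x) exp(i x y)]: the inverse transform
   without its factor [1 / (2 pi)]. *)
Definition invT p q y := cosT p y - sinT q y.

(** Differentiation multiplies [p + i q] by [i x], which sends the pair [(p, q)] to
    [(- x q, x p)]. *)
Lemma is_derive_invT M p q y : L2b M p -> L2b M q ->
  is_derive y 1 (invT p q) (invT (fun x => - (x * q x)) (fun x => x * p x) y).
Proof.
move=> lp lq.
have dc := is_derive_cosT y (L2b_L1 lp) (L2b_L1 (L2bX lp)).
have ds := is_derive_sinT y (L2b_L1 lq) (L2b_L1 (L2bX lq)).
apply: is_derive_eq; rewrite /invT addrC; congr (_ + _).
rewrite -mulN1r cosTZ; last exact: L2b_L1 (L2bX lq).
by apply: int_eq => x; rewrite mulN1r mulNr.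
Qed.

Lemma L2bN M f : L2b M f -> L2b M (fun x => - f x).
Proof. by move=> /(L2bZ (-1)); under eq_fun do rewrite mulN1r. Qed.

Lemma derive1n_invT M p q (k : nat) : L2b M p -> L2b M q ->
  exists p' q', [/\ L2b M p', L2b M q' & derive1n k (invT p q) = invT p' q'].
Proof.
move=> lp lq; elim: k => [|k [p' [q' [lp' lq' E]]]]; first by exists p, q.
exists (fun x => - (x * q' x)), (fun x => x * p' x); split.
- exact/L2bN/L2bX.
- exact: L2bX.
- rewrite derive1nS E; apply/funext => y; rewrite derive1E.
  by have [] := is_derive_invT y lp' lq'.
Qed.

Lemma smooth_on_invT M p q D : L2b M p -> L2b M q -> smooth_on D (invT p q).
Proof.
move=> lp lq k x _; have [p' [q' [lp' lq' ->]]] := derive1n_invT k lp lq.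
by have [] := is_derive_invT x lp' lq'.
Qed.

(** The operator multiplies [p + i q] by the symbol [a - x^2 + i b x]; the two arguments on the
    right are the real and imaginary parts of the product. *)
Lemma invT_polynomial M p q (a b y : R) : L2b M p -> L2b M q ->
  derive1n 2 (invT p q) y + b * derive1n 1 (invT p q) y + a * invT p q y =
  invT (fun x => (a - x ^+ 2) * p x - b * x * q x)
       (fun x => (a - x ^+ 2) * q x + b * x * p x) y.
Proof.
move=> lp lq.
have D1 : derive1n 1 (invT p q) = invT (fun x => - (x * q x)) (fun x => x * p x).
  apply/funext => z; rewrite derive1n1 derive1E.
  by have [] := is_derive_invT z lp lq.
have lp' := L2bN (L2bX lq); have lq' := L2bX lp.
have D2 z : derive1n 2 (invT p q) z =
    invT (fun x => - (x * (x * p x))) (fun x => x * - (x * q x)) z.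
  by rewrite derive1nS D1 derive1E; have [] := is_derive_invT z lp' lq'.
rewrite D2 D1 /invT.
have l1 f : L2b M f -> L1 f by exact: L2b_L1.
rewrite (_ : cosT (fun x => (a - _) * p x - _) y =
  cosT (fun x => - (x * (x * p x))) y + b * cosT (fun x => - (x * q x)) y +
  a * cosT p y); last first.
  rewrite cosTZ ?cosTZ; [|exact/l1|exact/l1].
  rewrite /cosT -intD; last 2 first.
  - by apply: L1_cosM; apply: l1; exact: (L2bN (L2bX (L2bX lp))).
  - by apply: L1Z; apply: L1_cosM; exact: l1.
  rewrite -intD; last 2 first.
  - apply: L1D; last by apply: L1Z; apply: L1_cosM; exact: l1.
    by apply: L1_cosM; apply: l1; exact: (L2bN (L2bX (L2bX lp))).
  - by apply: L1Z; apply: L1_cosM; exact: l1.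
  by apply: int_eq => x; ring.
rewrite (_ : sinT (fun x => (a - _) * q x + _) y =
  sinT (fun x => x * - (x * q x)) y + b * sinT (fun x => x * p x) y +
  a * sinT q y); last first.
  rewrite sinTZ ?sinTZ; [|exact/l1|exact/l1].
  rewrite /sinT -intD; last 2 first.
  - by apply: L1_sinM; apply: l1; exact: (L2bX lp').
  - by apply: L1Z; apply: L1_sinM; exact: l1.
  rewrite -intD; last 2 first.
  - apply: L1D; last by apply: L1Z; apply: L1_sinM; exact: l1.
    by apply: L1_sinM; apply: l1; exact: (L2bX lp').
  - by apply: L1Z; apply: L1_sinM; exact: l1.
  by apply: int_eq => x; ring.
ring.
Qed.

(** Replacing [q] by [- q] turns the inverse transform into the real part of a forward one, to which
    the complex Bessel inequality applies; the square of the imaginary part is dropped. *)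
Lemma invT_norm_le M p q : L2b M p -> L2b M q ->
  L1 (fun t => invT p q t ^+ 2) /\
  \int[mu]_t (invT p q t ^+ 2) <= 2 * pi * \int[mu]_x (p x ^+ 2 + q x ^+ 2).
Proof.
move=> lp lq; have lnq := L2bN lq.
have [l b] := bessel_complex lp.1 lnq.1 lp.2 lnq.2.
have E t : invT p q t = reT p (fun x => - q x) t.
  rewrite /invT /reT; congr (_ + _).
  rewrite -mulN1r sinTZ ?(L2b_L1 lq)//.
  by apply: int_eq => x; rewrite mulN1r mulNr.
have l' : L1 (fun t => invT p q t ^+ 2).
  apply: L1_le l.
    apply: measurable_funX; apply: measurable_funB.
      exact: measurable_cosT (L2b_L1 lp).
    exact: measurable_sinT (L2b_L1 lq).
  by move=> x; rewrite ger0_norm ?sqr_ge0// E lerDl sqr_ge0.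
split=> //; apply: (@le_trans _ _ _ _ _ _ (le_trans b _)).
  by apply: int_le => // t; rewrite E lerDl sqr_ge0.
by rewrite ler_wpM2l ?mulr_ge0 ?pi_ge0//; under int_eq do rewrite sqrrN.
Qed.

(** By Lebesgue differentiation [r x] is, for almost every [x], the derivative of its integral from
    [a], which vanishes near every [x > a]. *)
Lemma ae_eq0_of_int r a : L1 r ->
  (forall y, a < y -> \int[mu]_t (\1_`[a, y] t * r t) = 0) ->
  {ae mu, forall x, a < x -> r x = 0}.
Proof.
move=> lr H.
have ir y : mu.-integrable `[a, y] (EFin \o r).
  exact: (integrableS measurableT) lr.
have loc : locally_integrable setT r.
  by have := integrable_locally measurableT lr; rewrite patch_setT.
have := @FTC1 R r (BLeft a) ir loc.
apply: filterS; first exact: (ae_filter_ringOfSetsType mu).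
move=> x /= h ax; have [|_ <-] := h; first by rewrite lte_fin.
rewrite derive1E (@near_eq_derive _ _ _ _ (cst 0)).
  by rewrite derive_cst.
have : \forall y \near x, a < y by exact: lt_nbhsr.
by apply: filterS => y ay; rewrite -[LHS]int_indic_itv H.
Qed.

End InverseTransform.

(** * The band class *)

Section BandFourier.
Context {R : realType}.
Local Notation mu := (@lebesgue_measure R).
Implicit Types (e x y A M T : R) (f g h p q : R -> R) (F gt : R -> R[i]).

Lemma L2_Lfun f : f \in Lfun mu 2%:E -> L2 f.
Proof.
move=> lf; split; last exact: Lfun2_integrable_sqr.
by have := sub_Lfun_mfun lf; rewrite inE.
Qed.

Lemma normc_sqr (z : R[i]) :
  Normc.normc z ^+ 2 = complex.Re z ^+ 2 + complex.Im z ^+ 2.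
Proof. by case: z => a b /=; rewrite sqr_sqrtr// addr_ge0 ?sqr_ge0. Qed.

Lemma normc_ge0 (z : R[i]) : 0 <= Normc.normc z.
Proof. by case: z => a b /=; rewrite sqrtr_ge0. Qed.

Lemma CL2normE F : CL2norm F =
  sqrte (\int[mu]_x (complex.Re (F x) ^+ 2 + complex.Im (F x) ^+ 2)%:E)%E.
Proof.
rewrite /CL2norm unlock /Lnorm poweR12_sqrt; last first.
  by apply: integral_ge0 => x _; exact: poweR_ge0.
congr sqrte; apply: eq_integral => x _.
by rewrite abse_EFin poweR_EFin powR_mulrn// ger0_norm ?normc_ge0// normc_sqr.
Qed.

Lemma CL2norm_ge0 F : (0 <= CL2norm F)%E.
Proof. by rewrite CL2normE sqrte_ge0. Qed.

Lemma L1_CL2 F : in_CL2 F ->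
  L1 (fun x => complex.Re (F x) ^+ 2 + complex.Im (F x) ^+ 2).
Proof.
by move=> [/L2_Lfun l1 /L2_Lfun l2]; apply: L1D; [exact: l1.2|exact: l2.2].
Qed.

Lemma CL2norm_sqr F : in_CL2 F ->
  (CL2norm F ^+ 2 =
    (\int[mu]_x (complex.Re (F x) ^+ 2 + complex.Im (F x) ^+ 2))%:E)%E.
Proof.
move=> lF; rewrite CL2normE sqr_sqrte.
  by rewrite int_EFin//; exact: L1_CL2.
by apply: integral_ge0 => x _; rewrite lee_fin addr_ge0 ?sqr_ge0.
Qed.

Lemma truncated_fourierE gt A v : in_CL2 gt ->
  truncated_fourier gt A v =
  Complex
    (reT (trunc A (fun t => complex.Re (gt t))) (trunc A (fun t => complex.Im (gt t))) v)
    (imT (trunc A (fun t => complex.Re (gt t))) (trunc A (fun t => complex.Im (gt t))) v).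
Proof.
move=> [/L2_Lfun l1 /L2_Lfun l2].
have t1 : L1 (trunc A (fun t => complex.Re (gt t))).
  exact: L2_L1 (L2_trunc A l1) (@trunc_eq0 _ A _).
have t2 : L1 (trunc A (fun t => complex.Im (gt t))).
  exact: L2_L1 (L2_trunc A l2) (@trunc_eq0 _ A _).
rewrite /truncated_fourier /Cintegral; congr Complex.
  rewrite -int_indic_itv /reT /cosT /sinT -intD; [|exact: L1_cosM|exact: L1_sinM].
  apply: int_eq => t; rewrite /trunc; case: (gt t) => a b /=; ring.
rewrite -int_indic_itv /imT /cosT /sinT -intB; [|exact: L1_cosM|exact: L1_sinM].
apply: int_eq => t; rewrite /trunc; case: (gt t) => a b /=; ring.
Qed.

Lemma fourier_approx gt F : is_fourier gt F -> forall A0 d : R, 0 < d ->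
  exists2 A, A0 <= A &
    \int[mu]_v
      ((reT (trunc A (fun t => complex.Re (gt t)))
            (trunc A (fun t => complex.Im (gt t))) v - complex.Re (F v)) ^+ 2 +
       (imT (trunc A (fun t => complex.Re (gt t)))
            (trunc A (fun t => complex.Im (gt t))) v - complex.Im (F v)) ^+ 2) <= d.
Proof.
move=> [lgt lF cv] A0 d d0; have [/L2_Lfun l1 /L2_Lfun l2] := lgt.
(* The norm is the root of the integral to be bounded by [d]. *)
have sd0 : 0 < Num.sqrt d by rewrite sqrtr_gt0.
have nb : nbhs (0%E : \bar R) [set y : \bar R | (y < (Num.sqrt d)%:E)%E].
  by apply: open_nbhs_nbhs; split; [exact: open_ereal_lt_ereal|rewrite /= lte_fin].
have [A [/= A0A HA]] : exists A, A0 <= A /\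
    (CL2norm (fun nu => (truncated_fourier gt A nu - F nu)%R) < (Num.sqrt d)%:E)%E.
  have pr : ProperFilter (nbhs (+oo : set_system R)) by exact: proper_pinfty_nbhs.
  apply: (@filter_ex _ _ pr).
  by apply: filterI; [apply: nbhs_pinfty_ge; exact: num_real|exact: cv nb].
exists A => //.
move: HA; rewrite CL2normE.
set X := reT _ _; set Y := imT _ _.
rewrite (_ : (\int[mu]_x _)%E = (\int[mu]_v ((X v - complex.Re (F v)) ^+ 2 +
    (Y v - complex.Im (F v)) ^+ 2)%:E)%E); last first.
  apply: eq_integral => v _; rewrite truncated_fourierE// -/X -/Y.
  by case: (F v).
move=> /ltW H; rewrite -lee_fin -(sqr_sqrtr (ltW d0)).
set I := (X in (X%:E <= _)%E).
have [lP lQ] := lF; move/L2_Lfun : lP => lP; move/L2_Lfun : lQ => lQ.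
have lX : L2 X by exact: L2_reT_trunc.
have lY : L2 Y by exact: L2_imT_trunc.
have lD : L1 (fun v => (X v - complex.Re (F v)) ^+ 2 + (Y v - complex.Im (F v)) ^+ 2).
  by apply: L1D; [exact: (L2B lX lP).2|exact: (L2B lY lQ).2].
move: H; rewrite int_EFin// -/I.
have I0 : 0 <= I by apply: Rintegral_ge0 => v _; rewrite addr_ge0 ?sqr_ge0.
rewrite /= !lee_fin => H; rewrite -[leLHS](sqr_sqrtr I0).
by rewrite lerXn2r// nnegrE sqrtr_ge0.
Qed.

(** Off the support each point has a neighbourhood where [F] vanishes almost everywhere, but
    uncountably many null sets need not add up to one. Intervals with rational end points reduce
    them to a countable family. *)
Lemma ess_support_ae F J : ess_support F `<=` J ->
  {ae mu, forall v, ~ J v -> F v = 0}.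
Proof.
move=> FJ.
pose U (k : rat * rat) : set R := `]ratr k.1, ratr k.2[%classic.
(* [n] codes a rational interval. [N n] is its exceptional set if [F] vanishes almost everywhere on
   it, and empty otherwise, so each [N n] is negligible. *)
pose N (n : nat) : set R := if unpickle n is Some k then
  if `[< {ae mu, forall y, U k y -> F y = 0} >] then
    ~` [set y | U k y -> F y = 0] else set0 else set0.
have negN n : mu.-negligible (N n).
  rewrite /N; case: unpickle => [k|]; last exact: negligible_set0.
  by case: ifPn => [/asboolP//|_]; exact: negligible_set0.
apply: negligibleS (negligible_bigcup negN) => v /= /not_implyP[nJ Fv].
have : ~ ess_support F v by move=> /FJ.
rewrite /ess_support/= => /existsNP[V /not_implyP[nV /contrapT aeV]].
have [d /= d0 dV] := nV.
have [q1 q1P] : exists q : rat, ratr q \in `]v - d, v[.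
  by apply: rat_in_itvoo; rewrite gtrBl.
have [q2 q2P] : exists q : rat, ratr q \in `]v, v + d[.
  by apply: rat_in_itvoo; rewrite ltrDl.
have [n nE] : exists n, unpickle n = Some (q1, q2).
  by exists (pickle (q1, q2)); exact: pickleK.
exists n; first exact: I.
rewrite /N nE.
move: q1P q2P; rewrite !in_itv/= => /andP[a1 a2] /andP[b1 b2].
rewrite ifT.
  by apply/not_implyP; split => //; rewrite /U/= in_itv/= a2 b1.
apply/asboolP; apply: filterS aeV; first exact: (ae_filter_ringOfSetsType mu).
move=> y Hy; rewrite /U/= in_itv/= => /andP[c1 c2]; apply: Hy.
apply: dV; rewrite /= distrC ltr_distl; apply/andP; split.
  by rewrite (lt_trans a1).
by rewrite (lt_trans c2).
Qed.

End BandFourier.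

(** * The differential operator on band-limited functions *)

Section BandOperator.
Context {R : realType}.
Local Notation mu := (@lebesgue_measure R).
Implicit Types (e x y A M T : R) (f g h k p q : R -> R) (F gt : R -> R[i]).

(** Continuity would spread a difference at one point over an interval, and a null set contains
    none. *)
Lemma continuous_ae_eq T h k : {in `]0, T[, continuous h} -> {in `]0, T[, continuous k} ->
  ae_eq mu [set` `]0, T[] h k -> {in `]0, T[, h =1 k}.
Proof.
move=> ch ck [N [mN N0 hkN]] x xT; apply: contrapT => /eqP hk.
have c : {for x, continuous (fun y => h y - k y)}.
  by apply: continuousB; [exact: ch|exact: ck].
have n1 : \forall y \near x, h y - k y != 0.
  by apply: (cvgr_neq0 _ c); rewrite subr_eq0.
have n2 : \forall y \near x, y \in `]0, T[ by exact: near_in_itvoo.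
have [d /= d0 dP] : nbhs x [set y | h y - k y != 0 /\ y \in `]0, T[].
  by apply: filterS2 n1 n2.
pose U : set R := `]x - d, x + d[%classic.
have sub : U `<=` N.
  move=> y; rewrite /U/= in_itv/= => /andP[y1 y2]; apply: hkN => /=.
  have [] := dP y; first by rewrite /= distrC ltr_distl y1 y2.
  move=> hky yT; apply/not_implyP; split=> // E.
  by move: hky; rewrite E subrr eqxx.
have : (mu U <= mu N)%E by apply: le_measure; rewrite ?inE//; exact: measurable_itv.
rewrite /U lebesgue_measure_itv/= lte_fin ifT; last by clear -d0; lra.
rewrite N0 -EFinD lee_fin => {N0}; clear -d0; lra.
Qed.

Lemma derive1n_eq_in T h k n : {in `]0, T[, h =1 k} ->
  {in `]0, T[, derive1n n h =1 derive1n n k}.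
Proof.
move=> hk; elim: n => [|n IH]; first exact: hk.
move=> x xT; rewrite !derive1nS !derive1E; apply: near_eq_derive.
have := near_in_itvoo xT.
by apply: filterS => y; exact: IH.
Qed.

(** Makes the chosen representative computable: on (0,T) any smooth representative has the same
    derivatives. *)
Lemma derive1n_smooth_rep T g G n : is_smooth_rep T g G ->
  {in `]0, T[, derive1n n (smooth_rep T g) =1 derive1n n G}.
Proof.
move=> sG; apply: derive1n_eq_in.
have sh : is_smooth_rep T g (smooth_rep T g) by exact: (@xgetI _ g _ G).
have c f : is_smooth_rep T g f -> {in `]0, T[, continuous f}.
  move=> [sf _] x xT; apply: differentiable_continuous; apply/derivable1_diffP.
  by apply: (sf 0%N x); rewrite /= xT.
apply: continuous_ae_eq; [exact: c|exact: c|].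
exact: ae_eq_trans (ae_eq_sym sh.2) sG.2.
Qed.

Lemma int_ae_eq f g : L1 f -> measurable_fun setT g ->
  {ae mu, forall x, f x = g x} -> \int[mu]_x f x = \int[mu]_x g x.
Proof.
move=> lf mg fg; congr fine; apply: ae_eq_integral => //.
- by apply/measurable_EFinP; exact: L1_measurable.
- exact/measurable_EFinP.
- apply: filterS fg; first exact: (ae_filter_ringOfSetsType mu).
  by move=> x -> _.
Qed.

(** Fubini moves the transform from [p] onto the indicator, since the kernel [cos (t v)] is
    symmetric. *)
Lemma int_indic_cosT p x y : L1 p ->
  \int[mu]_t (\1_`[x, y] t * cosT p t) = \int[mu]_v (p v * cosT \1_`[x, y] v).
Proof.
move=> lp.
have mk : measurable_fun setT (fun p : R * R => cos (p.1 * p.2)).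
  apply: (measurableT_comp _ (@measurable_prod_mul R)).
  by apply: continuous_measurable_fun; exact: continuous_cos.
have [_ /= E] := fubini_kernel (L1_indic x y) lp mk (fun z => norm_cos_le1 _).
rewrite /cosT E; apply: int_eq => v; congr (_ * _).
by apply: int_eq => t; rewrite (mulrC t).
Qed.

Lemma int_indic_sinT p x y : L1 p ->
  \int[mu]_t (\1_`[x, y] t * sinT p t) = \int[mu]_v (p v * sinT \1_`[x, y] v).
Proof.
move=> lp.
have mk : measurable_fun setT (fun p : R * R => sin (p.1 * p.2)).
  apply: (measurableT_comp _ (@measurable_prod_mul R)).
  by apply: continuous_measurable_fun; exact: continuous_sin.
have [_ /= E] := fubini_kernel (L1_indic x y) lp mk (fun z => norm_sin_le1 _).
rewrite /sinT E; apply: int_eq => v; congr (_ * _).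
by apply: int_eq => t; rewrite (mulrC t).
Qed.

Lemma L2_invT M p q : L2b M p -> L2b M q -> L2 (invT p q).
Proof.
move=> lp lq; split; last by have [] := invT_norm_le lp lq.
apply: measurable_funB; first exact: measurable_cosT (L2b_L1 lp).
exact: measurable_sinT (L2b_L1 lq).
Qed.

Lemma ae_eq_invT f M p q T : 0 < T -> L2 f -> L2b M p -> L2b M q ->
  (forall x y, x < y -> \int[mu]_v (p v * cosT \1_`[x, y] v - q v * sinT \1_`[x, y] v) =
    \int[mu]_t (\1_`[x, y] t * f t)) ->
  ae_eq mu [set` `]0, T[] f (invT p q).
Proof.
move=> T0 lf lp lq H; set G := invT p q.
have lG : L2 G by exact: L2_invT lp lq.
have l1p := L2b_L1 lp; have l1q := L2b_L1 lq.
have lD : L2 (fun t => f t - G t) by exact: L2B.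
have E x y : x < y -> \int[mu]_t (\1_`[x, y] t * (f t - G t)) = 0.
  move=> xy; have li := L2_indic x y.
  under int_eq do rewrite mulrBr.
  rewrite intB; [|exact: L2_mul|exact: L2_mul].
  rewrite -H// /G /invT; under [X in _ - X]int_eq do rewrite mulrBr.
  have mc : L1 (fun t => \1_`[x, y] t * cosT p t).
    apply: (L1Mb (L1_indic x y) (measurable_cosT l1p)) => t; exact: norm_cosT_le.
  have ms : L1 (fun t => \1_`[x, y] t * sinT q t).
    apply: (L1Mb (L1_indic x y) (measurable_sinT l1q)) => t; exact: norm_sinT_le.
  rewrite [X in _ - X]intB// int_indic_cosT// int_indic_sinT// intB ?subrr//.
  - by apply: L2_mul; [exact: lp.1|have [] := L2T_indic x y].
  - by apply: L2_mul; [exact: lq.1|have [] := L2T_indic x y].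
(* [f - G] is square integrable on the line but perhaps not integrable. Cutting it to [[0, T]]
   repairs this and turns [[0, y]] into [[0, min y T]]. *)
pose r t := \1_`[0, T] t * (f t - G t).
have lr : L1 r by apply: L2_mul => //; exact: L2_indic.
have := @ae_eq0_of_int R r 0 lr.
have Er y : 0 < y -> \int[mu]_t (\1_`[0, y] t * r t) = 0.
  move=> y0; rewrite -[RHS](E 0 (Num.min y T)); last by rewrite lt_min y0.
  apply: int_eq => t; rewrite /r mulrA; congr (_ * _).
  rewrite !indicE !mem_setE !in_itv/= le_min.
  by case: (0 <= t); case: (t <= y); case: (t <= T); rewrite /= ?mulr1 ?mul1r ?mulr0 ?mul0r.
move=> /(_ Er); apply: filterS; first exact: (ae_filter_ringOfSetsType mu).
move=> t rt /=; rewrite in_itv/= => /andP[t0 tT].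
have := rt t0; rewrite /r indicE mem_setE in_itv/= (ltW t0) (ltW tT) mul1r.
by move=> /eqP; rewrite subr_eq0 => /eqP.
Qed.

Lemma compact_sym_bounded (I : set R) : compact I -> exists M : R,
  forall v, (I `|` (-%R @` I)) v -> `|v| <= M.
Proof.
move=> /compact_bounded[M0 [_ HM]]; exists (M0 + 1) => v.
have h z : I z -> `|z| <= M0 + 1 by apply: HM; rewrite ltrDl.
by case=> [/h//|[z /h zM <-]]; rewrite normrN.
Qed.

Lemma measurable_sym (I : set R) : compact I -> measurable (I `|` (-%R @` I)).
Proof.
move=> cI; apply: measurableU; first exact: compact_measurable.
apply: compact_measurable; apply: continuous_compact => //.
by apply: continuous_subspaceT => x; exact: opp_continuous.
Qed.

(** Stated for one extension and any bound [D] of the symbol on [I]. The real part of [gt] is the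
    one to invert, because [g] is real. *)
Lemma band_operator_le T (I : set R) g gt (a b D : R) : 0 < T -> compact I ->
  band_extension T I g gt ->
  (forall v, I v -> (a - v ^+ 2) ^+ 2 + (b * v) ^+ 2 <= D ^+ 2) ->
  exists G, [/\ is_smooth_rep T g G,
    L2 (fun t => derive1n 2 G t + b * derive1n 1 G t + a * G t) &
    \int[mu]_t ((derive1n 2 G t + b * derive1n 1 G t + a * G t) ^+ 2) <=
    D ^+ 2 * \int[mu]_t (complex.Re (gt t) ^+ 2 + complex.Im (gt t) ^+ 2)].
Proof.
move=> T0 cI [lgt gtg [F FT FJ]] HD.
have [_ lF _] := FT.
have [/L2_Lfun l1 /L2_Lfun l2] := lgt.
have [/L2_Lfun lP /L2_Lfun lQ] := lF.
set f1 := fun x => complex.Re (gt x) in l1.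
set f2 := fun x => complex.Im (gt x) in l2.
set P := fun x => complex.Re (F x) in lP.
set Q := fun x => complex.Im (F x) in lQ.
set J := I `|` (-%R @` I) in FJ.
have [M HM] := compact_sym_bounded cI; have mJ := measurable_sym cI.
rewrite -/J in HM mJ.
(* [F] vanishes off [J] only almost everywhere; cutting with the indicator gives a support bounded
   at every point. *)
pose P1 v := P v * \1_J v; pose Q1 v := Q v * \1_J v.
have restr f : L2 f -> L2b M (fun v => f v * \1_J v).
  move=> lf; split.
    apply: (@L2Mb _ f (\1_J) 1) => //.
    by move=> v; rewrite indicE; case: (_ \in _); rewrite ?normr1 ?normr0.
  move=> v Mv; rewrite indicE memNset ?mulr0// => /HM.
  by rewrite leNgt Mv.
have lP1 : L2b M P1 := restr _ lP; have lQ1 : L2b M Q1 := restr _ lQ.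
have PQ1 : {ae mu, forall v, P v = P1 v /\ Q v = Q1 v}.
  have := ess_support_ae FJ.
  apply: filterS; first exact: (ae_filter_ringOfSetsType mu).
  move=> v Fv; rewrite /P1 /Q1 indicE; have [_|/negP vJ] := boolP (v \in J).
    by rewrite !mulr1.
  rewrite !mulr0 /P /Q Fv//.
  by move=> vJ'; apply: vJ; rewrite inE.
have approx : forall A0 d : R, 0 < d -> exists2 A, A0 <= A &
    \int[mu]_v ((reT (trunc A f1) (trunc A f2) v - P1 v) ^+ 2 +
               (imT (trunc A f1) (trunc A f2) v - Q1 v) ^+ 2) <= d.
  move=> A0 d d0; have [A A0A HA] := fourier_approx FT A0 d0.
  exists A => //; apply: le_trans HA; rewrite le_eqVlt; apply/orP; left; apply/eqP.
  set X := reT _ _; set Y := imT _ _.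
  have lX : L2 X by exact: L2_reT_trunc.
  have lY : L2 Y by exact: L2_imT_trunc.
  apply: int_ae_eq.
  - by apply: L1D; [exact: (L2B lX lP1.1).2|exact: (L2B lY lQ1.1).2].
  - apply: L1_measurable.
    by apply: L1D; [exact: (L2B lX lP).2|exact: (L2B lY lQ).2].
  - apply: filterS PQ1; first exact: (ae_filter_ringOfSetsType mu).
    by move=> v [<- <-].
have norm := fourier_norm_le l1 l2 lP1.1 lQ1.1 approx.
have pi0 : 0 < 2 * pi :> R by rewrite mulr_gt0 ?pi_gt0.
(* The inversion factor left out of [invT]. *)
set c := (2 * pi)^-1 : R.
have c0 : 0 < c by rewrite invr_gt0.
pose p v := c * P1 v; pose q v := c * Q1 v.
have lp : L2b M p by exact: L2bZ.
have lq : L2b M q by exact: L2bZ.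
exists (invT p q).
have aeG : ae_eq mu [set` `]0, T[] f1 (invT p q).
  apply: ae_eq_invT lp lq _ => // x y xy.
  have [lc ls] := L2T_indic x y.
  rewrite -[RHS](mulKf (lt0r_neq0 pi0)) -(fourier_indic l1 l2 lP1.1 lQ1.1 approx xy) -/c.
  rewrite -intZ; last by apply: L1B; apply: L2_mul => //; [exact: lP1.1|exact: lQ1.1].
  by apply: int_eq => v; rewrite /p /q; ring.
have E t : derive1n 2 (invT p q) t + b * derive1n 1 (invT p q) t + a * invT p q t =
    _ := invT_polynomial a b t lp lq.
set p' := (fun x => (a - x ^+ 2) * p x - b * x * q x) in E.
set q' := (fun x => (a - x ^+ 2) * q x + b * x * p x) in E.
have lp' : L2b M p'.
  have -> : p' = (fun x => (a * p x + - (x * (x * p x))) + - (b * (x * q x))).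
    by apply/funext => x; rewrite /p'; ring.
  by apply: L2bD; [apply: L2bD; [exact: L2bZ|exact/L2bN/L2bX/L2bX]|exact/L2bN/L2bZ/L2bX].
have lq' : L2b M q'.
  have -> : q' = (fun x => (a * q x + - (x * (x * q x))) + (b * (x * p x))).
    by apply/funext => x; rewrite /q'; ring.
  by apply: L2bD; [apply: L2bD; [exact: L2bZ|exact/L2bN/L2bX/L2bX]|exact/L2bZ/L2bX].
have [lu bu] := invT_norm_le lp' lq'.
split.
- split; first exact: smooth_on_invT lp lq.
  apply: (ae_eq_trans _ aeG); apply: filterS gtg.
  by move=> t h /h; rewrite /f1 => ->.
- by rewrite (funext E); exact: L2_invT lp' lq'.
- rewrite (int_eq (g := fun t => invT p' q' t ^+ 2)); last by move=> t; rewrite E.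
  apply: (le_trans bu).
  apply: (@le_trans _ _ (2 * pi * \int[mu]_v (D ^+ 2 * c ^+ 2 * (P1 v ^+ 2 + Q1 v ^+ 2)))).
    rewrite ler_wpM2l ?(ltW pi0)//; apply: int_le.
    + by apply: L1D; [exact: lp'.1.2|exact: lq'.1.2].
    + by apply: L1Z; apply: L1D; [exact: lP1.1.2|exact: lQ1.1.2].
    + move=> v.
      (* Squared moduli multiply: [p' + i q'] is [p + i q] times the symbol. *)
      have -> : p' v ^+ 2 + q' v ^+ 2 =
          ((a - v ^+ 2) ^+ 2 + (b * v) ^+ 2) * (c ^+ 2 * (P1 v ^+ 2 + Q1 v ^+ 2)).
        by rewrite /p' /q' /p /q; ring.
      rewrite -mulrA; have [vJ|vJ] := pselect (J v).
        rewrite ler_wpM2r//; first by rewrite mulr_ge0 ?addr_ge0 ?sqr_ge0.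
        (* The squared modulus of the symbol is even in [v], so the bound on [I] also holds on
           [-I]. *)
        case: vJ => [/HD//|[z Iz zv]].
        by have := HD z Iz; rewrite -zv sqrrN mulrN sqrrN.
      by rewrite /P1 /Q1 indicE memNset// !mulr0 expr0n/= addr0 !mulr0.
  have lPQ : L1 (fun v => P1 v ^+ 2 + Q1 v ^+ 2).
    by apply: L1D; [exact: lP1.1.2|exact: lQ1.1.2].
  rewrite (intZ _ lPQ).
  apply: (@le_trans _ _ (2 * pi * (D ^+ 2 * c ^+ 2 *
      (2 * pi * \int[mu]_t (f1 t ^+ 2 + f2 t ^+ 2))))).
    rewrite ler_wpM2l ?(ltW pi0)// ler_wpM2l//.
    by rewrite mulr_ge0// sqr_ge0.
  (* The two Bessel factors [2 pi] cancel against [c ^+ 2]. *)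
  rewrite le_eqVlt; apply/orP; left; apply/eqP.
  rewrite -/f1 -/f2 /c; set S := Rintegral _ _ _.
  rewrite [LHS](_ : _ = (2 * pi * (2 * pi)^-1) ^+ 2 * (D ^+ 2 * S)); last by ring.
  by rewrite mulfV ?lt0r_neq0// expr1n mul1r.
Qed.

End BandOperator.

(** * The control *)

Section ControlBound.
Context {R : realType}.
Local Notation mu := (@lebesgue_measure R).

Lemma dsymbol_sqr (N : nat) (gamma omega : 'I_N -> R) alpha v :
  dsymbol gamma omega alpha v ^+ 2 =
  (omega alpha ^+ 2 + gamma alpha ^+ 2 - v ^+ 2) ^+ 2 + (2 * gamma alpha * v) ^+ 2.
Proof. by rewrite /dsymbol normc_sqr /=; simpc => /=; ring. Qed.

(** Compactness bounds the symbol on [I]; for an unbounded set of values [sup] would be the default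
    0. *)
Lemma dsymbol_le_dsup (N : nat) (gamma omega : 'I_N -> R) alpha (I : set R) v :
  compact I -> I v -> dsymbol gamma omega alpha v <= dsup gamma omega alpha I.
Proof.
move=> cI Iv; have [M HM] := compact_sym_bounded cI.
apply: ub_le_sup; last by exists v.
set a := omega alpha ^+ 2 + gamma alpha ^+ 2.
exists (Num.sqrt ((`|a| + M ^+ 2) ^+ 2 + (2 * gamma alpha * M) ^+ 2)) => _ [z Iz <-].
have zM : `|z| <= M by apply: HM; left.
have M0 : 0 <= M by rewrite (le_trans _ zM).
rewrite -[leLHS]ger0_norm ?normc_ge0// -sqrtr_sqr dsymbol_sqr -/a ler_wsqrtr//.
have z2 : z ^+ 2 <= M ^+ 2.
  by rewrite -(real_normK (num_real z)) lerXn2r// nnegrE.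
rewrite lerD//; last by rewrite !exprMn ler_wpM2l// mulr_ge0 ?sqr_ge0.
rewrite -(real_normK (num_real (a - _))) lerXn2r ?nnegrE//.
  by rewrite addr_ge0 ?sqr_ge0.
by rewrite (le_trans (ler_normB _ _))// lerD2l ger0_norm ?sqr_ge0.
Qed.

Lemma dsup_ge0 (N : nat) (gamma omega : 'I_N -> R) alpha (I : set R) :
  compact I -> 0 <= dsup gamma omega alpha I.
Proof.
move=> cI; have [->|/set0P[v Iv]] := eqVneq I set0.
  by rewrite /dsup image_set0 sup0.
exact: le_trans (normc_ge0 _) (dsymbol_le_dsup gamma omega alpha cI Iv).
Qed.

Lemma band_norm_ge0 T (I : set R) g : (0 <= band_norm T I g)%E.
Proof. by apply: le_ereal_inf_tmp => _ [gt _ <-]; exact: CL2norm_ge0. Qed.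

Lemma component_control (N : nat) (gamma omega : 'I_N -> R) T eta alpha t :
  component (control gamma omega T eta) alpha t =
  derive1n 2 (smooth_rep T (component eta alpha)) t +
  2 * gamma alpha * derive1n 1 (smooth_rep T (component eta alpha)) t +
  (omega alpha ^+ 2 + gamma alpha ^+ 2) * smooth_rep T (component eta alpha) t.
Proof.
rewrite /component /control /Gamma /Kmx -scalemxAl !mul_diag_mx !mxE /=.
by rewrite mulrA.
Qed.

(** At the level of square roots the bound [sqrt U <= D r] is linear in the norm [r], so after
    division by [D] it passes to the infimum. Membership in the class makes the band norm finite. *)
Lemma le_sqr_band_norm T (I : set R) g (U D : R) : 0 <= U -> 0 <= D ->
  in_band T I g ->
  (forall gt, band_extension T I g gt -> (U%:E <= (D ^+ 2)%:E * CL2norm gt ^+ 2)%E) ->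
  (U%:E <= (D ^+ 2)%:E * band_norm T I g ^+ 2)%E.
Proof.
move=> U0 D0 [_ [gt0 bgt0]] H.
have fin gt : band_extension T I g gt -> exists2 r : R, 0 <= r & CL2norm gt = r%:E.
  move=> [lgt _ _]; rewrite CL2normE int_EFin; last exact: L1_CL2.
  exists (Num.sqrt (\int[mu]_x (complex.Re (gt x) ^+ 2 + complex.Im (gt x) ^+ 2)));
    by rewrite ?sqrtr_ge0.
have [N NE] : exists N : R, band_norm T I g = N%:E.
  have [r r0 rE] := fin _ bgt0.
  have := @band_norm_ge0 T I g.
  have : (band_norm T I g <= r%:E)%E by rewrite -rE; apply: ereal_inf_lbound; exists gt0.
  by case: (band_norm T I g) => [N _ _|//|//]; exists N.
have := @band_norm_ge0 T I g; rewrite NE lee_fin => N0.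
rewrite -EFin_expe -EFinM lee_fin -exprMn.
have bnd r : 0 <= r -> U <= D ^+ 2 * r ^+ 2 -> Num.sqrt U <= D * r.
  move=> r0; rewrite -exprMn => /ler_wsqrtr/le_trans; apply.
  by rewrite sqrtr_sqr ger0_norm ?mulr_ge0.
suff h : Num.sqrt U <= D * N.
  by rewrite -[leLHS](sqr_sqrtr U0) lerXn2r ?nnegrE ?sqrtr_ge0 ?mulr_ge0.
(* When division by [D] is impossible, a single extension already gives [sqrt U <= 0]. *)
have [D00|Dn0] := eqVneq D 0.
  have [r r0 rE] := fin _ bgt0; have := H _ bgt0.
  rewrite rE -EFin_expe -EFinM lee_fin => /(bnd _ r0).
  by rewrite D00 !mul0r.
have Dp : 0 < D by rewrite lt_neqAle eq_sym Dn0.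
rewrite mulrC -ler_pdivrMr// -lee_fin -NE.
apply: le_ereal_inf_tmp => _ [gt bgt <-].
have [r r0 rE] := fin _ bgt; have := H _ bgt.
rewrite rE -EFin_expe -EFinM !lee_fin => /(bnd _ r0).
by rewrite ler_pdivrMr// mulrC.
Qed.

Lemma component_bound (N : nat) (gamma omega : 'I_N -> R) T (I : set R) eta alpha :
  0 < T -> compact I -> in_band T I (component eta alpha) ->
  measurable_fun `]0, T[ (component (control gamma omega T eta) alpha) /\
  ((\int[mu]_(t in `]0%R, T[)
      (component (control gamma omega T eta) alpha t ^+ 2)%:E) <=
    (dsup gamma omega alpha I ^+ 2)%:E * band_norm T I (component eta alpha) ^+ 2)%E.
Proof.
move=> T0 cI bI; set g := component eta alpha in bI *.
set a := omega alpha ^+ 2 + gamma alpha ^+ 2.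
set b := 2 * gamma alpha.
pose D := dsup gamma omega alpha I.
have D0 : 0 <= D by exact: dsup_ge0.
have HD v : I v -> (a - v ^+ 2) ^+ 2 + (b * v) ^+ 2 <= D ^+ 2.
  move=> Iv; rewrite -dsymbol_sqr lerXn2r// ?nnegrE ?normc_ge0//.
  exact: dsymbol_le_dsup.
(* [G] varies with the extension, but on (0,T) the control equals the operator applied to any such
   [G]. *)
have key gt : band_extension T I g gt -> exists G,
    [/\ {in `]0, T[, component (control gamma omega T eta) alpha =1
           (fun t => derive1n 2 G t + b * derive1n 1 G t + a * G t)},
        L2 (fun t => derive1n 2 G t + b * derive1n 1 G t + a * G t) &
        \int[mu]_t ((derive1n 2 G t + b * derive1n 1 G t + a * G t) ^+ 2) <=
        D ^+ 2 * \int[mu]_t (complex.Re (gt t) ^+ 2 + complex.Im (gt t) ^+ 2)].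
  move=> bgt; have [G [sG lG GD]] := band_operator_le T0 cI bgt HD.
  exists G; split => //.
  move=> t tT; rewrite component_control -/g.
  rewrite (derive1n_smooth_rep 2 sG tT) (derive1n_smooth_rep 1 sG tT).
  by have := derive1n_smooth_rep 0 sG tT; rewrite !derive1n0 => ->.
have [_ [gt0 bgt0]] := bI; have [G0 [uG0 lG0 _]] := key _ bgt0.
have mu0 : measurable_fun `]0, T[ (component (control gamma omega T eta) alpha).
  apply: eq_measurable_fun (measurable_funTS lG0.1) => t.
  by rewrite inE => /uG0.
split=> //.
have Ufin gt : band_extension T I g gt ->
  ((\int[mu]_(t in `]0%R, T[)
      (component (control gamma omega T eta) alpha t ^+ 2)%:E) <=
    (D ^+ 2)%:E * CL2norm gt ^+ 2)%E.
  move=> bgt; have [G [uG lG GD]] := key _ bgt; have [lgt _ _] := bgt.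
  rewrite CL2norm_sqr// -EFinM.
  apply: (@le_trans _ _
      (\int[mu]_t ((derive1n 2 G t + b * derive1n 1 G t + a * G t) ^+ 2))%:E);
    last by rewrite lee_fin.
  rewrite -int_EFin; last exact: lG.2.
  apply: (@le_trans _ _ (\int[mu]_(t in `]0%R, T[)
      ((derive1n 2 G t + b * derive1n 1 G t + a * G t) ^+ 2)%:E)%E).
    rewrite le_eqVlt; apply/orP; left; apply/eqP; apply: eq_integral => t.
    by rewrite inE => /uG ->.
  apply: ge0_subset_integral => //.
  - by apply/measurable_EFinP/measurable_funX; exact: lG.1.
  - by move=> t _; rewrite lee_fin sqr_ge0.
have U0 : (0 <= \int[mu]_(t in `]0%R, T[)
    (component (control gamma omega T eta) alpha t ^+ 2)%:E)%E.
  by apply: integral_ge0 => t _; rewrite lee_fin sqr_ge0.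
(* Finiteness of the integral is not known in advance; the bound from one extension excludes the
   infinite value. *)
move: U0 Ufin; case: integral => [U|_|//]; last first.
  move=> /(_ _ bgt0); have [lgt0 _ _] := bgt0.
  by rewrite CL2norm_sqr// -EFinM leye_eq.
by rewrite lee_fin => U0 Ufin; exact: le_sqr_band_norm.
Qed.

End ControlBound.

Theorem theorem4p2 (R : realType) (n Nc : nat)
    (omega : 'I_n -> R) (C : 'M[R]_(n, Nc)) (Cdag : 'M[R]_(Nc, n))
    (gammae omegae : 'I_Nc -> R)
    (T : R) (a addot : R -> 'cV[R]_n) (I : 'I_Nc -> set R)
    (homega : forall k, 0 < omega k)
    (hgammae : forall alpha, 0 < gammae alpha)
    (homegae : forall alpha, 0 < omegae alpha)
    (hT : 0 < T)
    (ha : in_H2 T a)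
    (haddot : vweak_derivative T 2 a addot)
    (hrank : \rank C = n)
    (hCdag : C *m Cdag = 1%:M)
    (hI : forall alpha, compact (I alpha) /\ I alpha `<=` `]0, +oo[) :
  let Lambda := diag_mx (\row_k (omega k ^+ 2)) in
  let eta := fun t => Cdag *m (addot t + Lambda *m a t) in
  let u := control gammae omegae T eta in
  (forall alpha, in_band T (I alpha) (component eta alpha)) ->
  (L2norm T u ^+ 2 <=
     \sum_alpha (dsup gammae omegae alpha (I alpha) ^+ 2)%:E
                * band_norm T (I alpha) (component eta alpha) ^+ 2)%E
  /\
  (L2norm T u <= (Delta gammae omegae I)%:E * prod_band_norm T I eta)%E.
Proof.
move=> Lambda eta u hband.
have cI alpha : compact (I alpha) by case: (hI alpha).
have cb alpha := component_bound gammae omegae hT (cI alpha) (hband alpha).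
set S := (\sum_alpha (dsup gammae omegae alpha (I alpha) ^+ 2)%:E
                * band_norm T (I alpha) (component eta alpha) ^+ 2)%E.
have L2le : (\int[lebesgue_measure]_(t in `]0%R, T[)
    (\sum_i component u i t ^+ 2)%R%:E <= S)%E.
  under eq_integral do rewrite -sumEFin.
  rewrite ge0_integral_sum//; first by apply: lee_sum => alpha _; exact: (cb alpha).2.
  - by move=> alpha; apply/measurable_EFinP/measurable_funX; exact: (cb alpha).1.
  - by move=> alpha t _; rewrite lee_fin sqr_ge0.
have I0 : (0 <= \int[lebesgue_measure]_(t in `]0%R, T[)
    (\sum_i component u i t ^+ 2)%R%:E)%E.
  by apply: integral_ge0 => t _; rewrite lee_fin sumr_ge0// => alpha _; rewrite sqr_ge0.
split; first by rewrite /L2norm sqr_sqrte.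
have D0 : 0 <= Delta gammae omegae I by exact: bigmax_ge_id.
(* Writing [Delta] as the root of its square brings the right side under one root, which leaves the
   first bound with each [dsup] enlarged to [Delta]. *)
rewrite -[Delta gammae omegae I]ger0_norm// -abse_EFin -sqrte_sqr.
rewrite /prod_band_norm -sqrteM; last exact: sqre_ge0.
have nneg : (0 <= (Delta gammae omegae I)%:E ^+ 2 *
   \sum_alpha band_norm T (I alpha) (component eta alpha) ^+ 2)%E.
  by rewrite mule_ge0 ?sqre_ge0// sume_ge0// => alpha _; exact: sqre_ge0.
rewrite /L2norm lee_sqrt//; apply: (le_trans L2le).
rewrite ge0_sume_distrr; last by move=> alpha _; exact: sqre_ge0.
apply: lee_sum => alpha _; apply: lee_wpmul2r; first exact: sqre_ge0.
rewrite -EFin_expe lee_fin lerXn2r ?nnegrE//; first exact: dsup_ge0.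
exact: (le_bigmax 0 (fun alpha => dsup gammae omegae alpha (I alpha))).
Qed.
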